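(* For every integer $d\ge 8$, the line arrangement $\mathcal A_d$ in $\mathbb P^2$ defined as follows satisfies $r(\mathcal A_d)=d-4$. For $p\ge 2$, $\mathcal A_{3p+2}$ is defined by $$xy\Big(\frac{x}{2^{p+1}}+\frac{y}{3^{p+1}}-z\Big)\prod_{j=1}^{p}\Big(\frac{x}{2^j}+\frac{y}{3^j}-z\Big)\Big(\frac{x}{2^j}+\frac{y}{3^{j+1}}-z\Big)\prod_{j=1}^{p-1}\Big(\frac{x}{2^j}+\frac{y}{3^{j+2}}-z\Big)=0,$$ $\mathcal A_{3p+3}=\mathcal A_{3p+2}\cup\{H_1\}$ with $H_1:27x-8y=0$, and $\mathcal A_{3p+4}=\mathcal A_{3p+3}\cup\{H_2\}$ with $H_2:x-y=0$.
   Context: $\mathbb K$ is a field of characteristic zero and $S=\mathbb K[x,y,z]$ with the standard grading. For a line arrangement $\mathcal A:f=0$ in $\mathbb P^2$ ($f\in S$ a product of pairwise non-proportional linear forms), $r(\mathcal A)$ is the minimal degree $r$ for which there is a nonzero triple $(a,b,c)\in S_r^3$ with $af_x+bf_y+cf_z=0$. The index $d$ of $\mathcal A_d$ is its number of lines. *)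

(* Defs.v *)
From HB Require Import structures.
From mathcomp Require Import all_boot all_order all_algebra.
From mathcomp Require Import mpoly.
From mathcomp Require Import zify.

Set Implicit Arguments.
Unset Strict Implicit.
Unset Printing Implicit Defensive.

Import GRing.Theory.
Local Open Scope ring_scope.

Notation ix := (@Ordinal 3 0 isT).
Notation iy := (@Ordinal 3 1 isT).
Notation iz := (@Ordinal 3 2 isT).

Section LineArrangements.
Variable K : fieldType.
Local Notation S := {mpoly K[3]}.

Definition line_arrangement (A : seq S) : Prop :=
  [/\ uniq A,
      {in A, forall l, (l \is 1.-homog) /\ l != 0}
    & {in A &, forall l m, l != m -> forall c : K, l != c *: m}].

Definition defpoly (A : seq S) : S := \prod_(l <- A) l.

(* [0] is homogeneous of every degree, so [r.-homog] is membership in S_r. *)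
Definition has_syzygy (f : S) (r : nat) : Prop :=
  exists a b c : S,
    [/\ [/\ a \is r.-homog, b \is r.-homog & c \is r.-homog],
        (a, b, c) != (0, 0, 0)
      & a * f^`M(ix) + b * f^`M(iy) + c * f^`M(iz) = 0].

Definition min_syzygy_degree (A : seq S) (r : nat) : Prop :=
  has_syzygy (defpoly A) r /\
  forall s : nat, has_syzygy (defpoly A) s -> (r <= s)%N.

Definition line23 (i j : nat) : S :=
  (2%:R ^+ i)^-1 *: 'X_ix + (3%:R ^+ j)^-1 *: 'X_iy - 'X_iz.

Definition arr_base (p : nat) : seq S :=
  'X_ix :: 'X_iy :: line23 p.+1 p.+1 ::
  [seq line23 j j | j <- iota 1 p] ++
  [seq line23 j j.+1 | j <- iota 1 p] ++
  [seq line23 j j.+2 | j <- iota 1 p.-1].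

Definition H1 : S := 27%:R *: 'X_ix - 8%:R *: 'X_iy.
Definition H2 : S := 'X_ix - 'X_iy.

(* The members 3p+2, 3p+3, 3p+4 of the family correspond to the three residues
   of d - 2 modulo 3; see [arrE0], [arrE1], [arrE2]. *)
Definition arr (d : nat) : seq S :=
  let p := ((d - 2) %/ 3)%N in
  match ((d - 2) %% 3)%N with
  | 0 => arr_base p
  | 1 => H1 :: arr_base p
  | _ => H2 :: H1 :: arr_base p
  end.

Lemma arrE0 p : arr (3 * p + 2) = arr_base p.
Proof.
by rewrite /arr addnK mulnC modnMl mulnK.
Qed.

Lemma arrE1 p : arr (3 * p + 3) = H1 :: arr (3 * p + 2).
Proof.
rewrite arrE0 /arr (_ : 3 * p + 3 - 2 = p * 3 + 1)%N; last by lia.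
by rewrite modnMDl divnMDl //= addn0.
Qed.

Lemma arrE2 p : arr (3 * p + 4) = H2 :: arr (3 * p + 3).
Proof.
rewrite arrE1 arrE0 /arr (_ : 3 * p + 4 - 2 = p * 3 + 2)%N; last by lia.
by rewrite modnMDl divnMDl //= addn0.
Qed.

Lemma arr_case d : (8 <= d)%N -> exists2 p, (2 <= p)%N &
  [\/ d = 3 * p + 2, d = 3 * p + 3 | d = 3 * p + 4]%N.
Proof.
move=> hd; exists ((d - 2) %/ 3)%N; first by lia.
have: (d = 3 * ((d - 2) %/ 3) + 2 \/ d = 3 * ((d - 2) %/ 3) + 3 \/
       d = 3 * ((d - 2) %/ 3) + 4)%N by lia.
by case=> [|[|]] h; [apply: Or31|apply: Or32|apply: Or33].
Qed.

Lemma size_arr d : (8 <= d)%N -> size (arr d) = d.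
Proof.
move=> /arr_case[p hp].
have hb : size (arr_base p) = (3 * p + 2)%N.
  by rewrite /= !size_cat !size_map !size_iota; lia.
by case=> ->; rewrite ?arrE2 ?arrE1 arrE0; move: (arr_base p) hb => s /= ->; lia.
Qed.

Lemma defpoly_arr_base p : (2 <= p)%N -> defpoly (arr (3 * p + 2)) =
  'X_ix * 'X_iy * line23 p.+1 p.+1 *
  (\prod_(1 <= j < p.+1) (line23 j j * line23 j j.+1)) *
  \prod_(1 <= j < p) line23 j j.+2.
Proof.
move=> hp; rewrite arrE0 /defpoly !big_cons !big_cat /= !big_map big_split /=.
by rewrite /index_iota !subn1 /= !mulrA.
Qed.

Local Notation cf l i := (l@_U_(i)).

Lemma line23_x i j : cf (line23 i j) ix = (2%:R ^+ i)^-1.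
Proof. by rewrite mcoeffB mcoeffD !mcoeffZ !mcoeffXU /= mulr1 mulr0 addr0 subr0. Qed.
Lemma line23_y i j : cf (line23 i j) iy = (3%:R ^+ j)^-1.
Proof. by rewrite mcoeffB mcoeffD !mcoeffZ !mcoeffXU /= mulr1 mulr0 add0r subr0. Qed.
Lemma line23_z i j : cf (line23 i j) iz = -1.
Proof. by rewrite mcoeffB mcoeffD !mcoeffZ !mcoeffXU /= !mulr0 !add0r. Qed.

Hypothesis char0 : [pchar K] =i pred0.

Let natK_eq0 n : (n%:R == 0 :> K) = (n == 0)%N.
Proof. exact: (GRing.pcharf0P K).1. Qed.

Let natK_inj (m n : nat) : m%:R = n%:R :> K -> m = n.
Proof.
wlog h : m n / (m <= n)%N.
  by move=> W; case/orP: (leq_total m n) => h e; [apply: W|symmetry; apply: W].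
move=> e; have : (n - m)%N%:R == 0 :> K by rewrite natrB // e subrr.
by rewrite natK_eq0; lia.
Qed.

Let line23_inj i j i' j' (c : K) : line23 i j = c *: line23 i' j' ->
  i = i' /\ j = j'.
Proof.
move=> e.
have hz := congr1 (mcoeff U_(iz)) e.
rewrite mcoeffZ !line23_z mulrN1 in hz; move/oppr_inj: hz => hz.
move: (congr1 (mcoeff U_(ix)) e) (congr1 (mcoeff U_(iy)) e).
rewrite !mcoeffZ !line23_x !line23_y -hz !mul1r => /invr_inj h2 /invr_inj h3.
move: h2 h3; rewrite -!natrX => /natK_inj h2 /natK_inj h3.
by split; [apply/eqP; rewrite -(eqn_exp2l (m := 2)) ?h2
          |apply/eqP; rewrite -(eqn_exp2l (m := 3)) ?h3].
Qed.

Definition base_codes (p : nat) : seq (nat * nat) :=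
  (p.+1, p.+1) :: [seq (j, j) | j <- iota 1 p] ++
  [seq (j, j.+1) | j <- iota 1 p] ++ [seq (j, j.+2) | j <- iota 1 p.-1].

Lemma uniq_base_codes p : uniq (base_codes p).
Proof.
rewrite /base_codes /= !mem_cat !cat_uniq !map_inj_uniq ?iota_uniq //=;
  try by move=> ? ? [].

apply/and4P; split=> //; last 1 first.
- apply/hasPn => u /mapP[j _ ->] /=.
  by apply/negP => /mapP[k _ [? ?]]; lia.
- rewrite !negb_or; apply/and3P; split; apply/negP => /mapP[j];
  by rewrite mem_iota => hj [? ?]; lia.
- apply/hasPn => u; rewrite mem_cat => /orP[] /mapP[j _ ->] /=;
  by apply/negP => /mapP[k _ [? ?]]; lia.
Qed.

Lemma arr_baseE p :
  arr_base p = 'X_ix :: 'X_iy :: [seq line23 u.1 u.2 | u <- base_codes p].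
Proof. by rewrite /arr_base /base_codes /= !map_cat -!map_comp. Qed.

Inductive arr_form : S -> Prop :=
| FX : arr_form 'X_ix
| FY : arr_form 'X_iy
| FL i j : arr_form (line23 i j)
| FH1 : arr_form H1
| FH2 : arr_form H2.

Let mem_arr_base p l : l \in arr_base p -> arr_form l.
Proof.
rewrite arr_baseE 2!in_cons => /orP[/eqP->|/orP[/eqP->|]]; [exact: FX|exact: FY|].
by move=> /mapP[u _ ->]; exact: FL.
Qed.

Let mem_arr d l : l \in arr d -> arr_form l.
Proof.
rewrite /arr; case: (_ %% _)%N => [|[|n]]; rewrite ?inE; first exact: mem_arr_base.
- by case/orP => [/eqP->|/mem_arr_base //]; exact: FH1.
- case/orP => [/eqP->|/orP[/eqP->|/mem_arr_base //]]; [exact: FH2|exact: FH1].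
Qed.

Let arr_form_homog l : arr_form l -> l \is 1.-homog.
Proof.
have hX i : 'X_i \is [in K[3], 1.-homog] by rewrite dhomogX /= mdeg1.
by case=> *; rewrite ?(rpredB, rpredD, rpredZ).
Qed.

Let cfX (i j : 'I_3) : cf ('X_i : S) j = (i == j)%:R.
Proof. exact: mcoeffXU. Qed.

Let H1_x : cf H1 ix = 27%:R.
Proof. by rewrite mcoeffB !mcoeffZ !cfX /= mulr1 mulr0 subr0. Qed.
Let H1_y : cf H1 iy = - 8%:R.
Proof. by rewrite mcoeffB !mcoeffZ !cfX /= mulr1 mulr0 sub0r. Qed.
Let H1_z : cf H1 iz = 0.
Proof. by rewrite mcoeffB !mcoeffZ !cfX /= !mulr0 subr0. Qed.
Let H2_x : cf H2 ix = 1.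
Proof. by rewrite mcoeffB !cfX /= subr0. Qed.
Let H2_y : cf H2 iy = - 1.
Proof. by rewrite mcoeffB !cfX /= sub0r. Qed.
Let H2_z : cf H2 iz = 0.
Proof. by rewrite mcoeffB !cfX /= subr0. Qed.

Let cfE := (line23_x, line23_y, line23_z, H1_x, H1_y, H1_z, H2_x, H2_y, H2_z, cfX).

Let pow_neq0 n i : (n.+1%:R ^+ i)^-1 != 0 :> K.
Proof. by rewrite invr_neq0 // expf_neq0 // natK_eq0. Qed.

Let arr_form_neq0 l : arr_form l -> l != 0.
Proof.
case=> *; apply/eqP => e.
- by move: (congr1 (mcoeff U_(ix)) e) => /eqP; rewrite cfE mcoeff0 oner_eq0.
- by move: (congr1 (mcoeff U_(iy)) e) => /eqP; rewrite cfE mcoeff0 oner_eq0.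
- by move: (congr1 (mcoeff U_(iz)) e) => /eqP; rewrite cfE mcoeff0 oppr_eq0 oner_eq0.
- by move: (congr1 (mcoeff U_(ix)) e) => /eqP; rewrite cfE mcoeff0 natK_eq0.
- by move: (congr1 (mcoeff U_(ix)) e) => /eqP; rewrite cfE mcoeff0 oner_eq0.
Qed.

Let arr_form_prop l m c : arr_form l -> arr_form m -> l = c *: m -> l = m.
Proof.
move=> hl hm e.
have cross i j : cf l i * cf m j == cf l j * cf m i.
  by rewrite e !mcoeffZ mulrAC.
have pos (n : nat) : (0 < n)%N -> n%:R == 0 :> K = false.
  by rewrite natK_eq0; case: n.
have h19 : 27%:R - 8%:R = 19%:R :> K by rewrite -natrB.
have h8 : (8%:R == 27%:R :> K) = false by rewrite eq_sym -subr_eq0 h19 pos.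
move: {cross}(cross ix iy) (cross iy iz) (cross ix iz) e.
case: hl => [||i j||]; case: hm => [||i2 j2||];
  rewrite ?cfE /= ?(mulr0, mul0r, mulr1, mul1r, mulrN, mulNr, opprK);
  rewrite ?(oppr_eq0, eq_sym (0 : K), oner_eq0, eqr_opp) ?pos //;
  rewrite ?(negbTE (pow_neq0 _ _)) // ?h8 //; try by rewrite eq_sym h8.
by move=> _ _ _ /line23_inj[-> ->].
Qed.

Lemma uniq_arr d : uniq (arr d).
Proof.
have ne (l m : S) i : cf l i != cf m i -> l != m.
  by apply: contraNneq => ->.
have nez (l : S) p : cf l iz = 0 -> l \notin [seq line23 u.1 u.2 | u <- base_codes p].
  move=> h; apply/negP => /mapP[u _ e].
  by move/eqP: h; rewrite e line23_z oppr_eq0 oner_eq0.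
have hb p : uniq (arr_base p).
  rewrite arr_baseE 2!cons_uniq in_cons negb_or !nez ?cfE //.
  rewrite map_inj_uniq ?uniq_base_codes; last first.
    move=> [i j] [i' j'] /= e.
    by have /line23_inj[-> ->] : line23 i j = 1 *: line23 i' j' by rewrite scale1r.
  by rewrite !andbT (ne _ _ ix) // !cfE /= oner_eq0.
have h1 p : H1 \notin arr_base p.
  rewrite arr_baseE 2!in_cons 2!negb_or nez ?cfE // (ne _ _ iy) ?(ne _ _ ix) //;
  by rewrite ?cfE /= ?oppr_eq0 natK_eq0.
have h2 p : H2 \notin H1 :: arr_base p.
  rewrite arr_baseE 3!in_cons 3!negb_or nez ?cfE // (ne _ H1 ix) ?(ne _ 'X_ix iy) ?(ne _ _ ix) //;
  rewrite ?cfE /= ?oppr_eq0 ?oner_eq0 //.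
  by apply/eqP => /(@natK_inj 1 27).
rewrite /arr; case: (_ %% _)%N => [|[|n]]; first exact: hb.
  by apply/andP; split; [exact: h1|exact: hb].
by apply/and3P; split; [exact: h2|exact: h1|exact: hb].
Qed.

Lemma line_arrangement_arr d : line_arrangement (arr d).
Proof.
split; first exact: uniq_arr.
  by move=> l /mem_arr hl; split; [exact: arr_form_homog|exact: arr_form_neq0].
move=> l m /mem_arr hl /mem_arr hm neq c; apply: contraNneq neq => e.
by rewrite (arr_form_prop hl hm e).
Qed.

End LineArrangements.

(* Main.v *)
Require Import Defs.
From mathcomp Require Import all_boot all_order all_algebra.
From mathcomp Require Import mpoly.
From mathcomp Require Import ring zify.

(** Throughout, t stands for the derivation with coefficients (t ix, t iy, t iz)
    and E for the Euler derivation, whose coefficients are the variables.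

    Upper bound.  The lines y = 0 and line23 1 j for j = 1, 2, 3 pass through the
    point P = (2 : 0 : 1).  Write f = g h, with g the product of the lines of
    the arrangement through P and h the product of the others.  The derivative D
    in the direction P kills g, so D f = g (D h), while E f = d f = d g h; hence
    (D h) E - d h D kills f, and its degree is that of h, at most d - 4
    ([syzygy_of_point]).

    Lower bound.  A nonzero t killing f is logarithmic: t(l) is a multiple of l
    for every line l of the arrangement, because linear forms are prime and the
    lines are pairwise non-proportional.  Moreover t is no multiple of E, because
    E f = d f is not zero ([logder_of_syzygy]).  The engine is a deletion
    principle for such derivations ([has_logder_deletion]).  Let the line n meet
    more than r + 1 lines of A in pairwise distinct points, and let t be
    logarithmic of degree r for A and n.  On the plane n = 0 the field t is
    tangent to each of the lines cut out there, so the binary form X /\ t,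
    with X the position vector, of degree r + 1, vanishes at more than r + 1 points: it is zero.  Thus
    t = g E + n t', and t' is logarithmic for A, of degree r - 1, and still no
    multiple of E.  So if the least degree for N lines is at least N - 4, then it
    is at least N - 3 after adding a line that N - 2 of them meet in distinct
    points.

    It remains to build the arrangement by lines of this kind, starting from
    five lines that are tangent to no nonzero constant field.  The lines
    line23 i j that occur are those with 1 <= i <= j <= i + 2 and j <= p + 1; they
    are added by decreasing i, in the order (n, n + 2), (n, n + 1), (n, n)
    ([no_logder_ladder]).  Each one shares its intersection with x = 0 or y = 0
    with exactly two earlier lines, those with the same j or the same i, and has
    no other coincidence: three lines line23 i j are concurrent exactly when the
    points (2^-i, 3^-j) are collinear, and [codes_not_collinear] excludes this by
    comparing the slopes (1 - 3^-m) / (1 - 2^-k).  The line 27 x = 8 y meets x and y at one point, and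
    line23 1 3 and line23 2 2 at one point; the line x = y meets x, y and
    27 x = 8 y at one point; again two lines are lost each time
    ([no_logder_ladder_H1], [no_logder_ladder_H2]). *)

Set Implicit Arguments.
Unset Strict Implicit.
Unset Printing Implicit Defensive.

Import GRing.Theory.
Local Open Scope ring_scope.

(** * Counting, and vectors with three coordinates *)

Lemma size_le_count (T : eqType) (s r : seq T) (P : pred T) :
  uniq s -> {in s, forall x, ~~ P x -> x \in r} -> (size s <= count P s + size r)%N.
Proof.
move=> us h; rewrite -(count_predC P) leq_add2l -size_filter.
apply: uniq_leq_size => [|x]; first exact: filter_uniq.
by rewrite mem_filter => /andP[/= Px xs]; apply: h.
Qed.

Lemma pairwise_in2 (T : eqType) (s : seq T) (r : rel T) :
  ssrbool.symmetric r -> pairwise r s -> {in s &, forall x y, x != y -> r x y}.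
Proof.
move=> sym; elim: s => // z s IH /= /andP[/allP zs rs] x y; rewrite !inE.
move=> /orP[/eqP ->|xs] /orP[/eqP ->|ys]; rewrite ?eqxx //.
- by move=> _; apply: zs.
- by move=> _; rewrite sym; apply: zs.
- exact: IH.
Qed.

Lemma leq_pow23 e : (2 ^ e <= 3 ^ e)%N.
Proof. by case: e => // e; rewrite leq_exp2r. Qed.

Lemma ord3_ind (P : 'I_3 -> Prop) : P ix -> P iy -> P iz -> forall i, P i.
Proof.
move=> h0 h1 h2 [[|[|[|i]]] hi] //.
- by rewrite (_ : Ordinal hi = ix) //; apply: val_inj.
- by rewrite (_ : Ordinal hi = iy) //; apply: val_inj.
- by rewrite (_ : Ordinal hi = iz) //; apply: val_inj.
Qed.

Definition dot3 (R : nzRingType) (a b : 'I_3 -> R) : R :=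
  a ix * b ix + a iy * b iy + a iz * b iz.

Definition det3 (R : nzRingType) (a b c : 'I_3 -> R) : R :=
  a ix * (b iy * c iz - b iz * c iy) - a iy * (b ix * c iz - b iz * c ix)
  + a iz * (b ix * c iy - b iy * c ix).

(** Both x and t are orthogonal to n, so their cross product is a multiple of n;
    pairing with w, where n(w) = 1, shows that the factor is det(w, x, t).  The
    equation is the double cross product formula for det(m, l, x /\ t). *)
Lemma cross_of_kernel (R : comNzRingType) (n w x t l m : 'I_3 -> R) :
  dot3 n w = 1 -> dot3 n x = 0 -> dot3 n t = 0 ->
  det3 w x t * det3 n l m = dot3 l x * dot3 m t - dot3 l t * dot3 m x.
Proof.
move=> nw nx nt.
have cr i j k :
    dot3 n w * (x j * t k - x k * t j) = n i * det3 w x t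
      - (w j * (x k * dot3 n t - t k * dot3 n x)
         - w k * (x j * dot3 n t - t j * dot3 n x)) ->
    x j * t k - x k * t j = n i * det3 w x t.
  by rewrite nw nx nt mul1r => ->; ring.
have c0 : x iy * t iz - x iz * t iy = n ix * det3 w x t.
  by apply: cr; rewrite /dot3 /det3; ring.
have c1 : x iz * t ix - x ix * t iz = n iy * det3 w x t.
  by apply: cr; rewrite /dot3 /det3; ring.
have c2 : x ix * t iy - x iy * t ix = n iz * det3 w x t.
  by apply: cr; rewrite /dot3 /det3; ring.
have -> : dot3 l x * dot3 m t - dot3 l t * dot3 m x =
    (x iy * t iz - x iz * t iy) * (l iy * m iz - l iz * m iy)
    + (x iz * t ix - x ix * t iz) * (l iz * m ix - l ix * m iz)
    + (x ix * t iy - x iy * t ix) * (l ix * m iy - l iy * m ix).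
  by rewrite /dot3; ring.
by rewrite c0 c1 c2 /det3; ring.
Qed.

Definition cross3 (R : nzRingType) (b c : 'I_3 -> R) (i : 'I_3) : R :=
  if i == ix then b iy * c iz - b iz * c iy
  else if i == iy then b iz * c ix - b ix * c iz
  else b ix * c iy - b iy * c ix.

Lemma det3_cross (R : comNzRingType) (a b c : 'I_3 -> R) :
  det3 a b c = dot3 a (cross3 b c).
Proof. by rewrite /det3 /dot3 /cross3 /=; ring. Qed.

Lemma dot3_delta (R : comNzRingType) (i : 'I_3) (a : 'I_3 -> R) :
  dot3 (fun j => (j == i)%:R) a = a i.
Proof. by move: i; apply: ord3_ind; rewrite /dot3 /=; ring. Qed.

(** * Linear forms and restriction to a plane *)

Section LinearForms.
Variable K : fieldType.
Local Notation S := {mpoly K[3]}.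
Local Notation vec := 'rV[K]_3.
Implicit Types (u v w n : vec) (f g : S) (i : 'I_3).

Definition cst u i : S := (u 0 i)%:MP.
Definition var i : S := 'X_i.
Definition linform u : S := dot3 (cst u) var.

Lemma mcoeff_linform u i : (linform u)@_U_(i) = u 0 i.
Proof.
rewrite /linform /dot3 !mcoeffD !mcoeffCM !mcoeffXU.
by move: i; apply: ord3_ind => /=; rewrite !(mulr0, mulr1, addr0, add0r).
Qed.

Lemma linform_inj : injective linform.
Proof.
by move=> u v e; apply/rowP => i; rewrite -!mcoeff_linform e.
Qed.

Lemma linform_eq0 u : (linform u == 0) = (u == 0).
Proof.
have f0 : linform 0 = 0 by rewrite /linform /dot3 /cst !mxE mpolyC0 !mul0r !addr0.
by rewrite -{1}f0 (inj_eq linform_inj).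
Qed.

Lemma linform_sub_scale u v (c : K) : linform (u - c *: v) = linform u - c%:MP * linform v.
Proof. by rewrite /linform /dot3 /cst !mxE !mpolyCB !mpolyCM; ring. Qed.

Lemma linform_homog u : linform u \is 1.-homog.
Proof.
have hX i : 'X_i \is [in K[3], 1.-homog] by rewrite dhomogX /= mdeg1.
by rewrite /linform /dot3 /cst /var !mul_mpolyC !rpredD ?rpredZ.
Qed.

Lemma msizeM_leS f g a b :
  (msize f <= a.+1)%N -> (msize g <= b)%N -> (msize (f * g) <= a + b)%N.
Proof.
have [->|f0] := eqVneq f 0; first by rewrite mul0r msize0.
have [->|g0] := eqVneq g 0; first by rewrite mulr0 msize0.
by rewrite msizeM //; move: (msize f) (msize g) => k l; lia.
Qed.

Lemma msizeD_leW f g a :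
  (msize f <= a)%N -> (msize g <= a)%N -> (msize (f + g) <= a)%N.
Proof. by move=> hf hg; rewrite (leq_trans (msizeD_le _ _)) // geq_max hf. Qed.

Lemma msizeCM_leW (c : K) f a : (msize f <= a)%N -> (msize (c%:MP * f) <= a)%N.
Proof. by move=> hf; rewrite -(add0n a) msizeM_leS // msizeC leq_b1. Qed.

Lemma msize_linform_le u : (msize (linform u) <= 2)%N.
Proof.
by rewrite /linform /dot3 !(msizeD_leW, msizeCM_leW) // /var msizeX mdeg1.
Qed.

Lemma msize_linform u : u != 0 -> msize (linform u) = 2.
Proof.
rewrite -linform_eq0 => u0; apply/eqP; rewrite eqn_leq msize_linform_le ltnNge.
apply: contra u0 => /msize1_polyC u1; rewrite linform_eq0; apply/eqP/rowP => i.
by rewrite -mcoeff_linform u1 mcoeffC mnm1_eq0 mulr0 mxE.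
Qed.

Lemma msize_dot u (t : 'I_3 -> S) a :
  (forall i, msize (t i) <= a)%N -> (msize (dot3 (cst u) t) <= a)%N.
Proof. by move=> ht; rewrite /dot3 !(msizeD_leW, msizeCM_leW). Qed.

Lemma msize_linform_factor u f a : u != 0 ->
  (msize (linform u * f) <= a)%N -> (msize f <= a.-1)%N.
Proof.
move=> u0; have [->|f0] := eqVneq f 0; first by rewrite msize0.
by rewrite msizeM ?linform_eq0 // msize_linform //; move: (msize f) => k; lia.
Qed.

(** Substituting these for the variables projects onto the plane n = 0 along w when
    n(w) = 1.  The projection is a ring endomorphism with kernel (n), so the
    coordinate ring of the plane is realised inside S itself, which is a domain;
    no basis of the plane has to be chosen. *)
Definition proj_tuple n w : 3.-tuple S :=
  [tuple 'X_i - cst w i * linform n | i < 3].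

Local Notation proj n w := (comp_mpoly (proj_tuple n w)).

Lemma proj_var n w i : proj n w 'X_i = 'X_i - cst w i * linform n.
Proof. by rewrite comp_mpolyXU -tnth_nth tnth_mktuple. Qed.

Lemma projC n w c : proj n w c%:MP = c%:MP.
Proof. exact: comp_mpolyC. Qed.

Lemma proj_dot n w u (t : 'I_3 -> S) :
  proj n w (dot3 (cst u) t) = dot3 (cst u) (fun i => proj n w (t i)).
Proof. by rewrite /dot3 !rmorphD !rmorphM /cst /= !projC. Qed.

Lemma proj_linform n w u :
  proj n w (linform u) = linform (u - dot3 (u 0) (w 0) *: n).
Proof.
rewrite linform_sub_scale {1}/linform proj_dot /var /dot3 !proj_var.
by rewrite /linform /dot3 /cst !mpolyCD !mpolyCM /var; ring.
Qed.

Lemma proj_linform_self n w : dot3 (n 0) (w 0) = 1 -> proj n w (linform n) = 0.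
Proof. by move=> h; rewrite proj_linform h scale1r subrr; apply/eqP; rewrite linform_eq0. Qed.

Lemma sub_proj_dvd n w f : exists g, f - proj n w f = linform n * g.
Proof.
have hM p q : (exists g, p - proj n w p = linform n * g) ->
    (exists g, q - proj n w q = linform n * g) ->
    exists g, p * q - proj n w (p * q) = linform n * g.
  move=> [g hg] [h hh]; exists (g * q + proj n w p * h).
  rewrite rmorphM /= (_ : _ - _ = (p - proj n w p) * q
    + proj n w p * (q - proj n w q)); last by ring.
  by rewrite hg hh; ring.
have h1 (c : K) : exists g, c%:MP - proj n w c%:MP = linform n * g.
  by exists 0; rewrite projC subrr mulr0.
elim/mpolyind: f => [|c m p _ _ [h hh]].
  by exists 0; rewrite rmorph0 subrr mulr0.
have [g hg] : exists g, c *: 'X_[m] - proj n w (c *: 'X_[m]) = linform n * g.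
  rewrite -mul_mpolyC; apply: (hM) => //; rewrite mpolyXE_id.
  apply: (big_ind (fun q => exists g, q - proj n w q = linform n * g)) => [||i _].
  - by rewrite -mpolyC1.
  - exact: hM.
  elim: (m i) => [|k IH]; first by rewrite expr0 -mpolyC1.
  rewrite exprS; apply: (hM) => //; exists (cst w i).
  by rewrite proj_var; ring.
exists (g + h); rewrite rmorphD /= mulrDr -hg -hh; ring.
Qed.

Lemma proj_ker n w f : proj n w f = 0 -> exists g, f = linform n * g.
Proof. by move=> h; have [g] := sub_proj_dvd n w f; rewrite h subr0; exists g. Qed.

Lemma msize_proj n w f : (msize (proj n w f) <= msize f)%N.
Proof.
rewrite comp_mpolyEX (leq_trans (msize_sum _ _ _)) //.
rewrite big_seq; apply/bigmax_leqP_seq => m hm _.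
rewrite -mul_mpolyC; apply: msizeCM_leW.
apply: leq_trans (msize_mdeg_lt hm); rewrite comp_mpolyX mdegE.
elim/big_ind2: _ => [|f1 a f2 b h1 h2|i _]; first by rewrite msize1.
  by rewrite -addnS msizeM_leS.
rewrite tnth_mktuple; elim: (m i) => [|k IH]; first by rewrite expr0 msize1.
rewrite exprS -(add1n k) -addnS msizeM_leS //.
rewrite msizeD_leW ?msizeX ?mdeg1 // msizeN msizeCM_leW //.
exact: msize_linform_le.
Qed.

Lemma dual_vec u : u != 0 -> exists w, dot3 (u 0) (w 0) = 1.
Proof.
have ex i : u 0 i != 0 -> exists w, dot3 (u 0) (w 0) = 1.
  move=> ui; exists (\row_j ((j == i)%:R / u 0 i)); rewrite /dot3 !mxE.
  by move: i ui; apply: ord3_ind => ui /=; rewrite !mul0r mul1r divff //;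
     rewrite !mulr0 !(addr0, add0r).
move=> u0; have /existsP[i ui] : [exists i, u 0 i != 0].
  apply: contraNT u0 => /existsPn h; apply/eqP/rowP => i; rewrite mxE.
  by apply/eqP; rewrite -[_ == _]negbK h.
exact: ex ui.
Qed.

Lemma linform_prime u v f g : u != 0 -> (forall c, v != c *: u) ->
  linform v * f = linform u * g -> exists h, f = linform u * h.
Proof.
move=> u0 vu e; have [w uw] := dual_vec u0; apply: (proj_ker (w := w)).
have := congr1 (proj u w) e; rewrite !rmorphM /= proj_linform_self // mul0r.
move/eqP; rewrite mulf_eq0 proj_linform linform_eq0 subr_eq0 (negbTE (vu _)) /=.
by move/eqP.
Qed.

(** Pairwise non-proportional linear forms are coprime primes, so their product
    divides f; recall that msize is the degree plus one. *)
Lemma size_forms_dividing (s : seq vec) f :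
  {in s, forall u, u != 0} -> uniq s ->
  {in s &, forall u v, u != v -> forall c, v != c *: u} ->
  {in s, forall u, exists g, f = linform u * g} -> f != 0 -> (size s < msize f)%N.
Proof.
elim: s f => [|u s IH] f; first by rewrite lt0n msize_poly_eq0.
move=> s0 /andP[us uniq_s] indep dvd f0.
have u0 := s0 u (mem_head _ _).
have [g fE] := dvd u (mem_head _ _).
have g0 : g != 0 by apply: contra_neq f0 => g0; rewrite fE g0 mulr0.
rewrite fE msizeM ?linform_eq0 // msize_linform // add2n ltnS; apply: IH => //.
- by move=> v vs; apply: s0; rewrite inE vs orbT.
- by move=> v w vs ws; apply: indep; rewrite inE ?vs ?ws orbT.
- move=> v vs; have vin : v \in u :: s by rewrite inE vs orbT.
  have [h fh] := dvd v vin; apply: (@linform_prime v u g h); first exact: s0.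
    apply: indep => //; first exact: mem_head.
    by apply: contraNneq us => <-.
  by rewrite -fE fh.
Qed.

Lemma det3_cst u v w : det3 (cst u) (cst v) (cst w) = (det3 (u 0) (v 0) (w 0))%:MP.
Proof.
by rewrite /det3 /cst !(mpolyCD, mpolyCN, mpolyCM).
Qed.

Lemma det3_shear n u v (a b : K) :
  det3 (n 0) ((u - a *: n) 0) ((v - b *: n) 0) = det3 (n 0) (u 0) (v 0).
Proof. by rewrite /det3 !mxE; ring. Qed.

Lemma det3_scale n u (c : K) : det3 (n 0) (u 0) ((c *: u) 0) = 0.
Proof. by rewrite /det3 !mxE; ring. Qed.

(** The forms u - a n and v - b n are the restrictions of u and v to the plane
    n = 0: the lines u and v meet n in distinct points iff these restrictions
    are not proportional, which the determinant detects. *)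
Lemma shear_indep n u v (a b : K) : det3 (n 0) (u 0) (v 0) != 0 ->
  forall c, v - b *: n != c *: (u - a *: n).
Proof.
move=> h c; apply: contraNneq h => e.
by rewrite -(det3_shear n u v a b) e det3_scale.
Qed.

Lemma shear_neq0 n u v (a : K) : det3 (n 0) (u 0) (v 0) != 0 -> u - a *: n != 0.
Proof.
move=> h; apply: contraNneq h => e.
by rewrite -(det3_shear n u v a 0) e /det3 !mxE; apply/eqP; ring.
Qed.

(** * Logarithmic derivations and deletion of a line *)

Definition logarithmic (A : seq vec) (t : 'I_3 -> S) : Prop :=
  {in A, forall u, exists g, dot3 (cst u) t = linform u * g}.

Definition eulerian (t : 'I_3 -> S) : Prop := exists q, forall i, t i = q * 'X_i.

(** The coefficients have degree less than d and may be inhomogeneous: the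
    deletion argument divides by linear forms, and bounds on msize survive this
    without any splitting into homogeneous parts. *)
Definition has_logder (A : seq vec) (d : nat) : Prop :=
  exists t, [/\ forall i, (msize (t i) <= d)%N, logarithmic A t & ~ eulerian t].

(** Here B collects lines meeting n in pairwise distinct points.  On the plane
    n = 0 both t and the position vector are tangent to each line of B, so
    their wedge F, of degree at most d, is divisible by more than d linear
    forms and vanishes.  Hence t is a multiple of the position vector modulo n,
    and the quotient of the difference by n is the new derivation.  The last
    hypothesis on A says that no line of A coincides with n. *)
Lemma has_logder_deletion n (A B : seq vec) d :
  {subset B <= A} -> uniq B -> (d < size B)%N ->
  {in B &, forall u v, u != v -> det3 (n 0) (u 0) (v 0) != 0} ->
  {in A, forall u, exists v, det3 (n 0) (u 0) (v 0) != 0} ->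
  has_logder (n :: A) d -> has_logder A d.-1.
Proof.
move=> BA uniqB sizeB detB detA [t [t_deg t_log t_eul]].
have [u0 u0B] : exists u0, u0 \in B.
  by case: (B) sizeB => // u0 B' _; exists u0; rewrite mem_head.
have n0 : n != 0.
  have [v] := detA _ (BA _ u0B); apply: contraNneq => ->.
  by rewrite /det3 !mxE; apply/eqP; ring.
have [w nw] := dual_vec n0.
(* Restrictions to the plane of the position vector and of t. *)
pose xb i := proj n w 'X_i; pose tb i := proj n w (t i).
have dotx u : dot3 (cst u) xb = linform (u - dot3 (u 0) (w 0) *: n).
  by rewrite -proj_linform /linform proj_dot.
have nx : dot3 (cst n) xb = 0.
  by rewrite dotx nw scale1r subrr; apply/eqP; rewrite linform_eq0.
have nt : dot3 (cst n) tb = 0.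
  rewrite -proj_dot; have [g ->] := t_log n (mem_head _ _).
  by rewrite rmorphM /= proj_linform_self // mul0r.
have nwS : dot3 (cst n) (cst w) = 1.
  by rewrite -mpolyC1 -nw /dot3 /cst !(mpolyCD, mpolyCM).
have dott u : u \in A -> exists2 g,
    dot3 (cst u) t = linform u * g &
    dot3 (cst u) tb = dot3 (cst u) xb * proj n w g.
  move=> uA; have [|g hg] := t_log u; first by rewrite inE uA orbT.
  by exists g => //; rewrite -proj_dot hg rmorphM /= proj_linform dotx.
(* Since n(w) = 1, F is the factor of n in the cross product of xb and tb. *)
pose F := det3 (cst w) xb tb.
have F_eq0 : F = 0.
  apply/eqP; apply: contraTT sizeB => F0; rewrite -leqNgt.
  pose f u := u - dot3 (u 0) (w 0) *: n.
  rewrite -(size_map f) -ltnS.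
  have F_deg : (msize F <= d.+1)%N.
    have hxb i : (msize (xb i) <= 2)%N.
      by rewrite (leq_trans (msize_proj _ _ _)) // msizeX mdeg1.
    have htb i : (msize (tb i) <= d)%N by apply: leq_trans (msize_proj _ _ _) _.
    have hm i j : (msize (xb i * tb j - xb j * tb i) <= d.+1)%N.
      by rewrite -(add1n d) msizeD_leW ?msizeN ?msizeM_leS.
    rewrite /F det3_cross; apply: msize_dot; rewrite /cross3.
    by apply: ord3_ind => /=.
  apply: leq_trans F_deg; apply: size_forms_dividing => //.
  - move=> _ /mapP[u uB ->]; have [v] := detA u (BA u uB).
    exact: shear_neq0.
  - rewrite map_inj_in_uniq // => u v uB vB e.
    apply/eqP; apply: contraT => /(detB u v uB vB) h.
    by have := shear_indep (dot3 (u 0) (w 0)) (dot3 (v 0) (w 0)) h 1;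
       rewrite scale1r -/(f u) e eqxx.
  - move=> _ _ /mapP[u uB ->] /mapP[v vB ->] ne; apply: shear_indep.
    by apply: detB => //; apply: contraNneq ne => ->.
  (* F det(n, u, v) is a multiple of the restriction of u, by cross_of_kernel, and
     the determinant is a nonzero constant. *)
  - move=> _ /mapP[u uB ->]; have [v h] := detA u (BA u uB).
    have [g _ hg] := dott u (BA u uB).
    have := cross_of_kernel (cst u) (cst v) nwS nx nt.
    rewrite hg det3_cst -/F => e.
    exists ((dot3 (cst v) tb - proj n w g * dot3 (cst v) xb)
      * (det3 (n 0) (u 0) (v 0))^-1%:MP).
    rewrite -[LHS]mulr1 -mpolyC1 -(mulfV h) mpolyCM mulrA e -/(f u).
    by rewrite -(mulrA (dot3 _ xb)) -mulrBr -mulrA (dotx u).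
have u0A := BA _ u0B; have [g tg tbg] := dott u0 u0A.
(* Now F = 0 in cross_of_kernel, with a coordinate form as its last vector. *)
have tbE i : tb i = proj n w g * xb i.
  have [v /(shear_neq0 (dot3 (u0 0) (w 0)))] := detA u0 u0A.
  rewrite -linform_eq0 -dotx => u0x; apply: (mulfI u0x); apply/eqP.
  have := cross_of_kernel (cst u0) (fun j => (j == i)%:R) nwS nx nt.
  rewrite -/F F_eq0 mul0r tbg => /esym/eqP.
  rewrite !dot3_delta subr_eq0 -mulrA => /eqP h.
  by apply/eqP; rewrite h.
have u0n0 : u0 != 0.
  by have [v /(shear_neq0 0)] := detA u0 u0A; rewrite scale0r subr0.
have g_deg : (msize g <= d.-1)%N.
  by apply: (msize_linform_factor u0n0); rewrite -tg msize_dot.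
have ex i : exists p, t i = g * 'X_i + linform n * p.
  have [|p hp] := @proj_ker n w (t i - g * 'X_i).
    by rewrite rmorphB rmorphM /= -/(tb i) tbE subrr.
  by exists p; rewrite -hp; ring.
have [p0 h0] := ex ix; have [p1 h1] := ex iy; have [p2 h2] := ex iz.
pose p (i : 'I_3) := if i == ix then p0 else if i == iy then p1 else p2.
have tE i : t i = g * 'X_i + linform n * p i by move: i; apply: ord3_ind.
(* For d = 0 all coefficients vanish. *)
have d_gt0 : (0 < d)%N.
  rewrite lt0n; apply/eqP => d0; apply: t_eul; exists 0 => i.
  by rewrite mul0r; apply/eqP; rewrite -msize_poly_eq0 -leqn0; have := t_deg i; rewrite d0.
exists p; split.
- move=> i; apply: (msize_linform_factor n0).
  rewrite (_ : linform n * p i = t i - g * 'X_i); last by rewrite tE; ring.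
  rewrite msizeD_leW // msizeN mulrC -(prednK d_gt0) -(add1n d.-1) msizeM_leS //.
  by rewrite msizeX mdeg1.
- move=> u uA; have [v h] := detA u uA.
  have u_n0 : u != 0.
    by have := shear_neq0 0 h; rewrite scale0r subr0.
  have [h' _ _] := dott u uA.
  have [q hq] := t_log u (mem_behead (s := n :: A) uA).
  (* u divides t(u) - g u = n p(u) and is prime to n. *)
  apply: (@linform_prime u n _ (q - g)) => //.
    move=> c; apply: contraNneq h => ->; rewrite /det3 !mxE.
    by apply/eqP; ring.
  rewrite mulrBr -hq /linform /dot3 !tE /linform /dot3 /var; ring.
- move=> [q hq]; apply: t_eul; exists (g + linform n * q) => i.
  by rewrite tE hq; ring.
Qed.

Lemma has_logder_monotone A d e : (d <= e)%N -> has_logder A d -> has_logder A e.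
Proof.
move=> de [t [h1 h2 h3]]; exists t; split=> // i; exact: leq_trans (h1 i) de.
Qed.

(** * Jacobian syzygies *)

Definition derive (t : 'I_3 -> S) f : S := dot3 t (fun i => f^`M(i)).

Lemma deriveM t f g : derive t (f * g) = derive t f * g + f * derive t g.
Proof. by rewrite /derive /dot3 !mderivM; ring. Qed.

Lemma derive1 t : derive t 1 = 0.
Proof. by rewrite /derive /dot3 -mpolyC1 !mderivC !mulr0 !addr0. Qed.

Lemma derive_linform t u : derive t (linform u) = dot3 (cst u) t.
Proof.
have hX i j : ('X_i : S)^`M(j) = (i == j)%:R.
  rewrite mderivX mnm1E; case: eqP => [->|_]; last by rewrite scale0r.
  rewrite scale1r -mpolyX0; congr 'X_[_]; apply/mnmP => k.
  by rewrite mnmBE mnm0E subnn.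
rewrite /derive /linform {2}/dot3 /cst /var.
rewrite /dot3 !mderivD !mderiv_mulC !hX /=; ring.
Qed.

Lemma eq_derive t t' f : t =1 t' -> derive t f = derive t' f.
Proof. by move=> e; rewrite /derive /dot3 !e. Qed.

Lemma derive_comb (a b : S) t t' f :
  derive (fun i => a * t i + b * t' i) f = a * derive t f + b * derive t' f.
Proof. by rewrite /derive /dot3; ring. Qed.

Lemma derive_euler (s : seq vec) :
  derive var (\prod_(u <- s) linform u) = (size s)%:R * \prod_(u <- s) linform u.
Proof.
elim: s => [|u s IH]; first by rewrite big_nil derive1 mul0r.
rewrite big_cons deriveM IH derive_linform -/(linform u) /= -[(size s).+1]addn1 natrD.
by ring.
Qed.

Lemma prod_linform_neq0 (s : seq vec) :
  {in s, forall u, u != 0} -> \prod_(u <- s) linform u != 0.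
Proof.
move=> s0; rewrite prodf_seq_neq0; apply/allP => u us.
by rewrite /= linform_eq0 s0.
Qed.

Hypothesis char0 : [pchar K] =i pred0.

Lemma natS_eq0 m : (m%:R == 0 :> S) = (m == 0)%N.
Proof.
by rewrite -((pcharf0P K).1 char0) -mpolyC_nat mpolyC_eq0.
Qed.

(** Applied to f = u g, with g the product of the other lines, the Leibniz rule
    gives t(u) g = - u t(g), and u is prime to g. *)
Lemma logder_of_syzygy (A : seq vec) r :
  (0 < size A)%N -> uniq A -> {in A, forall u, u != 0} ->
  {in A &, forall u v, u != v -> forall c, v != c *: u} ->
  has_syzygy (defpoly (map linform A)) r -> has_logder A r.+1.
Proof.
move=> A_gt0 uniqA A0 indep [a [b [c [[ha hb hc] abc0 e]]]].
pose t (i : 'I_3) := if i == ix then a else if i == iy then b else c.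
have fE : defpoly (map linform A) = \prod_(u <- A) linform u by rewrite /defpoly big_map.
have tf : derive t (\prod_(u <- A) linform u) = 0 by rewrite -fE.
exists t; split.
- have deg f : f \is r.-homog -> (msize f <= r.+1)%N.
    move=> /dhomogP hf; rewrite msizeE big_seq; apply/bigmax_leqP_seq => m hm _.
    by rewrite (hf m hm).
  by apply: ord3_ind; rewrite /t /=; apply: deg.
- move=> u uA; have u0 := A0 u uA.
  have [w uw] := dual_vec u0; apply: (proj_ker (w := w)).
  pose g := \prod_(v <- rem u A) linform v.
  (* Nonzero because no other line is proportional to u. *)
  have g0 : g \mPo (proj_tuple u w) != 0.
    rewrite /g rmorph_prod prodf_seq_neq0; apply/allP => v /= vA.
    have [vu vinA] : v != u /\ v \in A by move: vA; rewrite mem_rem_uniq // inE => /andP.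
    by rewrite proj_linform linform_eq0 subr_eq0 indep // eq_sym.
  have := congr1 (fun f => f \mPo (proj_tuple u w)) tf.
  rewrite (big_rem u uA) /= -/g deriveM derive_linform rmorphD !rmorphM /= rmorph0.
  by rewrite proj_linform_self // mul0r addr0 => /eqP; rewrite mulf_eq0 (negbTE g0) orbF => /eqP.
- move=> [q tq]; move/eqP: tf.
  have -> : derive t (\prod_(u <- A) linform u) =
      q * ((size A)%:R * \prod_(u <- A) linform u).
    rewrite -derive_euler (eq_derive (t' := fun i => q * var i + 0 * var i)).
      by rewrite derive_comb mul0r addr0.
    by move=> i; rewrite mul0r addr0 tq.
  rewrite !mulf_eq0 natS_eq0 eqn0Ngt A_gt0 (negbTE (prod_linform_neq0 A0)) !orbF.
  move=> /eqP q0; case/eqP: abc0; move: (tq ix) (tq iy) (tq iz).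
  by rewrite q0 !mul0r /t /= => -> -> ->.
Qed.

(** The factor 'X_i avoids the subtraction size s - 1 in the degree. *)
Lemma homog_var_derive (p : vec) (s : seq vec) (i : 'I_3) :
  'X_i * derive (cst p) (\prod_(u <- s) linform u) \is (size s).-homog.
Proof.
have hX j : 'X_j \is [in K[3], 1.-homog] by rewrite dhomogX /= mdeg1.
elim: s => [|u s IH]; first by rewrite big_nil derive1 mulr0 dhomog0.
have hs : \prod_(v <- s) linform v \is (size s).-homog.
  elim: (s) => [|v r IHr]; first by rewrite big_nil dhomog1.
  by rewrite big_cons /= -(add1n (size r)) dhomogM ?linform_homog.
rewrite big_cons deriveM derive_linform /= -(add1n (size s)).
have -> : dot3 (cst u) (cst p) = (dot3 (u 0) (p 0))%:MP.
  by rewrite /dot3 /cst !(mpolyCD, mpolyCM).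
rewrite mulrDr mulrCA mul_mpolyC mulrCA rpredD ?rpredZ // dhomogM ?linform_homog //.
Qed.

(** With h the product of the lines off p and D the derivative in the direction p,
    the syzygy is (D h) E - (size A) h D. *)
Lemma syzygy_of_point (p : vec) (A : seq vec) :
  p != 0 -> (0 < size A)%N -> {in A, forall u, u != 0} ->
  has_syzygy (defpoly (map linform A)) (count (fun u : vec => dot3 (u 0) (p 0) != 0) A).
Proof.
move=> p0 A_gt0 A0.
pose B := [seq u : vec <- A | dot3 (u 0) (p 0) == 0].
pose C := [seq u : vec <- A | dot3 (u 0) (p 0) != 0].
rewrite -size_filter -/C.
have fE : defpoly (map linform A) = \prod_(u <- B) linform u * \prod_(u <- C) linform u.
  by rewrite /defpoly big_map /B /C !big_filter (bigID (fun u : vec => dot3 (u 0) (p 0) == 0)).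
have B0 : derive (cst p) (\prod_(u <- B) linform u) = 0.
  have : {in B, forall u, dot3 (u 0) (p 0) = 0}.
    by move=> u; rewrite mem_filter => /andP[/eqP].
  elim: (B) => [|u s IH] h; first by rewrite big_nil derive1.
  rewrite big_cons deriveM derive_linform IH ?mulr0 ?addr0; last first.
    by move=> v vs; apply: h; rewrite inE vs orbT.
  have -> : dot3 (cst u) (cst p) = (dot3 (u 0) (p 0))%:MP.
    by rewrite /dot3 /cst !(mpolyCD, mpolyCM).
  by rewrite h ?mem_head // mpolyC0 mul0r.
pose h := \prod_(u <- C) linform u.
have hC : h \is (size C).-homog.
  rewrite /h; elim: (C) => [|v r IHr]; first by rewrite big_nil dhomog1.
  by rewrite big_cons /= -(add1n (size r)) dhomogM ?linform_homog.
pose t i := derive (cst p) h * 'X_i + (- (size A)%:R * h) * cst p i.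
have t_homog i : t i \is (size C).-homog.
  rewrite /t mulrC rpredD ?homog_var_derive //.
  rewrite mulrC /cst mul_mpolyC rpredZ // -mpolyC_nat -mpolyCN mul_mpolyC.
  by rewrite rpredZ.
exists (t ix), (t iy), (t iz); split; first by split.
  have h0 : h != 0.
    by apply: prod_linform_neq0 => u; rewrite mem_filter => /andP[_ /A0].
  (* Eliminating D h between t i and t j leaves a multiple of p_i X_j - p_j X_i. *)
  have pE i j : i != j -> t i = 0 -> t j = 0 -> p 0 i = 0.
    move=> ij ti tj; have : (size A)%:R * h * (cst p i * 'X_j - cst p j * 'X_i) = 0.
      rewrite (_ : _ * _ = 'X_i * t j - 'X_j * t i); last by rewrite /t; ring.
      by rewrite ti tj !mulr0 subr0.
    move=> /eqP; rewrite !mulf_eq0 natS_eq0 eqn0Ngt A_gt0 (negbTE h0) /= => /eqP.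
    move=> /(congr1 (mcoeff U_(j))); rewrite mcoeffB !mcoeffCM !mcoeffXU mcoeff0.
    by rewrite eqxx (negbTE ij) mulr1 mulr0 subr0.
  apply: contraNneq p0 => e; apply/eqP/rowP => i; rewrite mxE; move: i.
  have tx : t ix = 0 := congr1 (fun q => q.1.1) e.
  have ty : t iy = 0 := congr1 (fun q => q.1.2) e.
  have tz : t iz = 0 := congr1 snd e.
  by apply: ord3_ind; [apply: (pE ix iy)|apply: (pE iy iz)|apply: (pE iz ix)].
have te : derive t (defpoly (map linform A)) =
    derive (cst p) h * derive var (defpoly (map linform A))
    + (- (size A)%:R * h) * derive (cst p) (defpoly (map linform A)).
  exact: derive_comb.
apply: etrans te _.
have := derive_euler A; rewrite -(big_map linform xpredT id) -/(defpoly _) => ->.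
by rewrite fE deriveM B0 -/h; ring.
Qed.

End LinearForms.

(** * Collinearity of the points (2^-i, 3^-j) *)

(** For a = 2^k, b = 3^m, c = 2^l, d = 3^n with k < l this compares the slopes
    (1 - 1/b) / (1 - 1/a) and (1 - 1/d) / (1 - 1/c) after clearing denominators.
    The condition 2 a <= b + 1 makes the first at least 1 / (1 - 1/c), the
    supremum of the second over d. *)
Lemma slope_ltn a b c d : (1 < a)%N -> (2 * a <= b + 1)%N -> (2 * a <= c)%N ->
  (0 < d)%N -> ((a - 1) * (d - 1) * c * b < (c - 1) * (b - 1) * a * d)%N.
Proof.
case: a => // a; case: d => // d a0 ab ac _.
have {ab}[b' ->] : exists b', b = 2 * a + 1 + b' by exists (b - (2 * a + 1))%N; lia.
have {ac}[c' ->] : exists c', c = 2 * a + 2 + c' by exists (c - (2 * a + 2))%N; lia.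
rewrite !subSS !subn0 (_ : 2 * a + 1 + b' - 1 = 2 * a + b')%N; last by lia.
rewrite (_ : 2 * a + 2 + c' - 1 = 2 * a + 1 + c')%N; last by lia.
nia.
Qed.

(** Equality is excluded by size as soon as 2^(k+1) <= 3^m + 1.  As |m - k| <= 2,
    only eight pairs (k, m) violate this.  For them an equality would make 2^l
    divide 2^k (3^m - 1), being prime to 2^l - 1 and to 3^n; this bounds l, and
    finitely many cases are left to computation. *)
Lemma slope_neq k l m n : (0 < k < l)%N -> (0 < m)%N -> (0 < n)%N ->
  (m <= k.+2)%N -> (k <= m.+2)%N -> (n <= l.+2)%N -> (l <= n.+2)%N ->
  ((2 ^ k - 1) * (3 ^ n - 1) * 2 ^ l * 3 ^ m
   != (2 ^ l - 1) * (3 ^ m - 1) * 2 ^ k * 3 ^ n)%N.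
Proof.
move=> /andP[k0 kl] m0 n0 mk km nl ln.
have [small|large] := leqP (2 * 2 ^ k)%N (3 ^ m + 1).
  rewrite neq_ltn slope_ltn ?expn_gt0 //; first by rewrite -(expn0 2) ltn_exp2l.
  by rewrite -expnS leq_exp2l.
(* 512 <= 729 starts the induction; for k >= 8 it gives 2^(k+1) <= 3^(k-2). *)
have pow8 j : (2 ^ (j + 9) <= 3 ^ (j + 6))%N.
  elim: j => // j IH; rewrite !addSn !expnS.
  exact: leq_mul.
have k7 : (k <= 7)%N.
  rewrite leqNgt; apply/negP => k8; move: large.
  rewrite ltnNge -expnS (leq_trans (_ : _ <= 3 ^ m)%N) ?leq_addr //.
  rewrite (_ : k.+1 = (k - 8) + 9)%N; last by lia.
  by apply: leq_trans (pow8 _) _; rewrite leq_exp2l //; lia.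
have {large k7 mk km m0} exc : (k, m) \in
    [:: (2, 1); (3, 1); (3, 2); (4, 2); (4, 3); (5, 3); (6, 4); (7, 5)]%N.
  move: k k0 kl mk km k7 large => [|[|[|[|[|[|[|[|k]]]]]]]] // _ _;
  by move: m m0 => [|[|[|[|[|[|[|[|[|[|m]]]]]]]]]] //; lia.
apply/eqP => e.
have dvd : (2 ^ l %| 2 ^ k * (3 ^ m - 1))%N.
  have co2 : coprime (2 ^ l) (2 ^ l - 1) by rewrite subn1 coprimenP ?expn_gt0.
  have co3 : coprime (2 ^ l) (3 ^ n) by apply/coprimeXl/coprimeXr.
  rewrite -(Gauss_dvdr _ co2) -(Gauss_dvdr _ co3).
  rewrite (_ : _ * _ = (2 ^ l - 1) * (3 ^ m - 1) * 2 ^ k * 3 ^ n)%N; last by lia.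
  by rewrite -e mulnAC dvdn_mull.
(* The largest 2^k (3^m - 1) is 128 * 242 = 30976 < 2^15. *)
have l14 : (l <= 14)%N.
  rewrite leqNgt; apply/negP => l15.
  have pos : (0 < 2 ^ k * (3 ^ m - 1))%N.
    move: exc; rewrite !inE.
    by repeat case/orP; move=> /eqP[-> ->].
  have := dvdn_leq pos dvd; apply/negP; rewrite -ltnNge.
  apply: (@leq_trans (2 ^ 15)%N); last by rewrite leq_exp2l.
  move: exc; rewrite !inE.
  repeat case/orP; move=> /eqP[-> ->]; lia.
have k2 : (1 < k)%N by move: exc; rewrite !inE; repeat case/orP; move=> /eqP[-> _].
have [h lE] : exists h, l = h.+3 by exists (l - 3)%N; lia.
have : n \in [:: h.+1; h.+2; h.+3; h.+4; h.+1.+4] by rewrite !inE; lia.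
move: e kl l14; rewrite {}lE => {dvd nl ln n0 k0 k2} e kl l14 nE.
move: exc nE e; rewrite !inE.
by repeat case/orP; move=> /eqP[? ?]; subst k m;
  repeat case/orP; move=> /eqP ->;
  move: h l14 kl => [|[|[|[|[|[|[|[|[|[|[|[|h]]]]]]]]]]]]; lia.
Qed.

(** The equation is the vanishing of the determinant of the points (2^-i, 3^-j, 1),
    cleared of denominators.  Seen from the first point, the other two either lie
    on different sides of its horizontal, or on one vertical, or have slopes
    compared by slope_neq. *)
Lemma codes_not_collinear i0 j0 i1 j1 i2 j2 :
  (i0 <= j0 <= i0.+2)%N -> (i1 <= j1 <= i1.+2)%N -> (i2 <= j2 <= i2.+2)%N ->
  (i0 < i1)%N -> (i0 < i2)%N -> j1 != j0 -> j2 != j0 -> (i1, j1) != (i2, j2) ->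
  (2 ^ i0 * 2 ^ i2 * 3 ^ j0 * 3 ^ j1 + 2 ^ i1 * 2 ^ i2 * 3 ^ j0 * 3 ^ j2
     + 2 ^ i0 * 2 ^ i1 * 3 ^ j1 * 3 ^ j2 !=
   2 ^ i0 * 2 ^ i2 * 3 ^ j1 * 3 ^ j2 + 2 ^ i1 * 2 ^ i2 * 3 ^ j0 * 3 ^ j1
     + 2 ^ i0 * 2 ^ i1 * 3 ^ j0 * 3 ^ j2)%N.
Proof.
wlog le12 : i1 j1 i2 j2 / (i1 <= i2)%N.
  move=> W h0 h1 h2 h3 h4 h5 h6 h7; have [le|/ltnW le] := leqP i1 i2; first exact: W.
  have := W i2 j2 i1 j1 le h0 h2 h1 h4 h3 h6 h5; rewrite eq_sym => /(_ h7).
  by apply: contraNneq => e; apply/eqP; lia.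
move=> h0 h1 h2 i01 i02 j10 j20 ne; apply/eqP => e.
(* The two points lie on one vertical line. *)
have [i12|i12] := eqVneq i1 i2.
  have j12 : j1 != j2 by apply: contraNneq ne => ->; rewrite i12.
  have lt01 : (2 ^ i0 < 2 ^ i2)%N by rewrite ltn_exp2l.
  have y0 : (0 < 3 ^ j0)%N by rewrite expn_gt0.
  have : (2 ^ i2 * 3 ^ j0 * ((2 ^ i2 - 2 ^ i0) * 3 ^ j1) ==
          2 ^ i2 * 3 ^ j0 * ((2 ^ i2 - 2 ^ i0) * 3 ^ j2))%N.
    apply/eqP; move: e; rewrite i12 -(subnKC (ltnW lt01)) addKn.
    by move: (2 ^ i2 - 2 ^ i0)%N => s e; lia.
  rewrite eqn_pmul2l ?muln_gt0 ?expn_gt0 // eqn_pmul2l ?subn_gt0 //.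
  by rewrite eqn_exp2l // (negbTE j12).
have j02 : (j0 < j2)%N by lia.
(* Both slopes are positive. *)
have [j01|j01] := ltnP j0 j1.
  have := @slope_neq (i1 - i0) (i2 - i0) (j1 - j0) (j2 - j0).
  case/(_ _ _ _ _ _ _ _)/eqP; try lia.
  move: e.
  rewrite -(subnKC (ltnW i01)) -(subnKC (ltnW i02)) -(subnKC (ltnW j01)) -(subnKC (ltnW j02)).
  rewrite !expnD !addKn.
  have := expn_gt0 2 i0; have := expn_gt0 3 j0.
  have := expn_gt0 2 (i1 - i0); have := expn_gt0 3 (j1 - j0).
  have := expn_gt0 2 (i2 - i0); have := expn_gt0 3 (j2 - j0).
  move: (3 ^ j0)%N (3 ^ (j1 - j0))%N (3 ^ (j2 - j0))%N (2 ^ i0)%N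
    (2 ^ (i1 - i0))%N (2 ^ (i2 - i0))%N => y b d x a c /= d0 c0 b0 a0 y0 x0 e.
  have {}e : (c * b + a * c * d + a * b * d = c * b * d + a * c * b + a * d)%N.
    apply/eqP; rewrite -(@eqn_pmul2l (x * x * y * y)) ?muln_gt0 ?x0 ?y0 //.
    by apply/eqP; lia.
  case: a a0 e => // a _; case: b b0 => // b _; case: c c0 => // c _.
  by case: d d0 => // d _ e; rewrite !subn1 /=; lia.
(* The slopes have opposite signs. *)
have {j01}j01 : (j1 < j0)%N by lia.
have lt1 : (3 ^ j1 < 3 ^ j0)%N by rewrite ltn_exp2l.
have lt2 : (3 ^ j0 < 3 ^ j2)%N by rewrite ltn_exp2l.
have lt3 : (2 ^ i0 < 2 ^ i1)%N by rewrite ltn_exp2l.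
have lt4 : (2 ^ i0 < 2 ^ i2)%N by rewrite ltn_exp2l.
have x0 : (0 < 2 ^ i0)%N by rewrite expn_gt0.
have y1 : (0 < 3 ^ j1)%N by rewrite expn_gt0.
move: (3 ^ j0)%N (3 ^ j1)%N (3 ^ j2)%N (2 ^ i0)%N (2 ^ i1)%N (2 ^ i2)%N
  e x0 y1 lt1 lt2 lt3 lt4 => y0 y1 y2 x0 x1 x2 e x0p y1p h1' h2' h3' h4'.
clear -e x0p y1p h1' h2' h3' h4'.
have [a ax] : exists a, x1 = (x0 + a.+1)%N by exists (x1 - x0.+1)%N; lia.
have [c cx] : exists c, x2 = (x0 + c.+1)%N by exists (x2 - x0.+1)%N; lia.
have [b yb] : exists b, y0 = (y1 + b.+1)%N by exists (y0 - y1.+1)%N; lia.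
have [d yd] : exists d, y2 = (y0 + d.+1)%N by exists (y2 - y0.+1)%N; lia.
move: e; rewrite {}yd {}yb {}ax {}cx {h1' h2' h3' h4'}.
by case: x0 x0p => // x _; case: y1 y1p => // y _; lia.
Qed.

(** The inequality says that a / 2^i + b / 3^j takes different values at the two
    codes.  Passing from i1 to a larger i2, the first summand drops by at least
    a / 2^(i1 + 1), while the second grows by at most
    b (3^-(i1+1) - 3^-(i1+2)); the first alternative of each disjunction makes the
    drop win, and under the second one the other summand does not grow. *)
Lemma weighted_codes_neq a b i1 j1 i2 j2 :
  (0 < a)%N -> (0 < b)%N -> (i1 <= j1 <= i1.+2)%N -> (i2 <= j2 <= i2.+2)%N ->
  (4 * b * 2 ^ i1 < 9 * a * 3 ^ i1)%N || (j1 <= i1.+1)%N ->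
  (4 * b * 2 ^ i2 < 9 * a * 3 ^ i2)%N || (j2 <= i2.+1)%N ->
  (i1, j1) != (i2, j2) ->
  (a * 2 ^ i2 * 3 ^ j1 * 3 ^ j2 + b * 2 ^ i1 * 2 ^ i2 * 3 ^ j2 !=
   a * 2 ^ i1 * 3 ^ j1 * 3 ^ j2 + b * 2 ^ i1 * 2 ^ i2 * 3 ^ j1)%N.
Proof.
move=> a0 b0; wlog le12 : i1 j1 i2 j2 / (i1 <= i2)%N.
  move=> W h1 h2 h3 h4 h5; have [le|/ltnW le] := leqP i1 i2; first exact: W.
  have := W i2 j2 i1 j1 le h2 h1 h4 h3; rewrite eq_sym => /(_ h5).
  by apply: contraNneq => e; apply/eqP; lia.
move=> h1 h2 w1 _ ne; rewrite neq_ltn; apply/orP; have [e|ne12] := eqVneq i1 i2.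
  have j12 : j1 != j2 by apply: contraNneq ne => ->; rewrite e.
  have : (b * 2 ^ i2 * 2 ^ i2 * 3 ^ j2 != b * 2 ^ i2 * 2 ^ i2 * 3 ^ j1)%N.
    by rewrite eqn_pmul2l ?muln_gt0 ?b0 ?expn_gt0 // eqn_exp2l // eq_sym.
  by rewrite e; lia.
have lt12 : (i1 < i2)%N by lia.
right; have : (2 * 2 ^ i1 <= 2 ^ i2)%N by rewrite -expnS leq_exp2l.
have x0 : (0 < 2 ^ i1)%N by rewrite expn_gt0.
have y0 : (0 < 3 ^ j1)%N by rewrite expn_gt0.
have y0' : (0 < 3 ^ j2)%N by rewrite expn_gt0.
have [le|lt] := leqP (3 ^ j1) (3 ^ j2).
  move: (2 ^ i1)%N (2 ^ i2)%N (3 ^ j1)%N (3 ^ j2)%N x0 y0 y0' le => x x' y y' x0 y0 y0' le hx.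
  have hl : (a * x * y * y' < a * x' * y * y')%N.
    by rewrite !ltn_pmul2r // ltn_pmul2l //; lia.
  have hr : (b * x * x' * y <= b * x * x' * y')%N by rewrite leq_mul2l le orbT.
  lia.
have {w1}w : (4 * b * 2 ^ i1 < 9 * a * 3 ^ i1)%N.
  by move: w1 lt; rewrite ltn_exp2l // => /orP[//|]; lia.
have q1 : (3 ^ j1 <= 9 * 3 ^ i1)%N.
  by rewrite (_ : 9 = 3 ^ 2)%N // -expnD leq_exp2l //; lia.
have q2 : (3 * 3 ^ i1 <= 3 ^ j2)%N by rewrite -expnS leq_exp2l //; lia.
move: (2 ^ i1)%N (2 ^ i2)%N (3 ^ j1)%N (3 ^ j2)%N (3 ^ i1)%N x0 y0 y0' lt w q1 q2.
move=> x x' y y' q x0 y0 y0' lt w q1 q2 hx.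
have h9 : (9 * q * (y - y') <= 2 * y * y')%N.
  have hA : (3 * q * y <= y' * y)%N by rewrite leq_mul2r q2 orbT.
  have hB : (y * y' <= 9 * q * y')%N by rewrite leq_mul2r q1 orbT.
  by rewrite mulnBr; lia.
have hb : (2 * b * x * (y - y') < a * y * y')%N.
  have q0 : (0 < 9 * q)%N by lia.
  rewrite -(ltn_pmul2l q0).
  have hC : (2 * b * x * (9 * q * (y - y')) <= 2 * b * x * (2 * y * y'))%N.
    by rewrite leq_mul2l h9 orbT.
  have hD : (4 * b * x * (y * y') < 9 * a * q * (y * y'))%N.
    by rewrite ltn_pmul2r // muln_gt0 y0.
  lia.
have hE : (x' * (2 * b * x * (y - y')) < x' * (a * y * y'))%N.
  by rewrite ltn_pmul2l //; lia.
have hF : (a * y * y' * (2 * x) <= a * y * y' * x')%N by rewrite leq_mul2l hx orbT.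
have [z zE] : exists z, y = (y' + z)%N by exists (y - y')%N; lia.
move: hE hF; rewrite {}zE addKn => hE hF; lia.
Qed.

(** * The combinatorics of the ladder *)

(** The pair (i, j) is the code of the line line23 i j. *)
Definition in_band (c : nat * nat) : bool := (c.1 <= c.2 <= c.1.+2)%N.

Fixpoint ladder (k n : nat) : seq (nat * nat) :=
  if k is k'.+1 then [:: (n, n), (n, n.+1), (n, n.+2) & ladder k' n.+1]
  else [:: (n, n); (n, n.+1); (n.+1, n.+1)].

Lemma mem_ladder k n c :
  (c \in ladder k n) = [&& in_band c, (n <= c.1)%N & (c.2 <= n + k.+1)%N].
Proof.
case: c => i j; rewrite /in_band.
elim: k n => [|k IH] n /=; rewrite !inE ?IH !xpair_eqE /=; apply/idP/idP; lia.
Qed.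

Lemma uniq_ladder k n : uniq (ladder k n).
Proof.
elim: k n => [|k IH] n /=; rewrite !inE !xpair_eqE ?mem_ladder ?IH /in_band /=; lia.
Qed.

Lemma size_ladder k n : size (ladder k n) = (3 * k + 3)%N.
Proof. by elim: k n => // k IH n /=; rewrite IH; lia. Qed.

Lemma mem_base_codes p : base_codes p.+2 =i ladder p.+1 1.
Proof.
move=> [i j]; rewrite mem_ladder /in_band /base_codes inE !mem_cat.
have m (f : nat -> nat) q : ((i, j) \in [seq (l, f l) | l <- iota 1 q])
    = [&& j == f i, 0 < i & i <= q]%N.
  apply/mapP/idP => [[l]|/and3P[/eqP -> i0 iq]].
    by rewrite mem_iota => hl [-> ->]; rewrite eqxx; lia.
  by exists i => //; rewrite mem_iota; lia.
rewrite (m id) (m S) (m (fun l => l.+2)) xpair_eqE /=; apply/idP/idP; lia.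
Qed.

(** * Independence of the lines *)

Section Arrangements.
Variable K : fieldType.
Hypothesis char0 : [pchar K] =i pred0.
Local Notation S := {mpoly K[3]}.
Local Notation vec := 'rV[K]_3.
Implicit Types (c : nat * nat) (u v w n : vec).

Definition mkvec (a b c : K) : vec :=
  \row_i (if i == ix then a else if i == iy then b else c).
Definition xvec : vec := mkvec 1 0 0.
Definition yvec : vec := mkvec 0 1 0.
Definition codevec c : vec := mkvec (2%:R ^+ c.1)^-1 (3%:R ^+ c.2)^-1 (-1).
(** The line b x = a y of the pencil through the common point of x and y. *)
Definition pencilvec (a b : nat) : vec := mkvec b%:R (- a%:R) 0.

Lemma linform_mkvec (a b c : K) :
  linform (mkvec a b c) = a *: 'X_ix + b *: 'X_iy + c *: 'X_iz.
Proof. by rewrite /linform /dot3 /cst !mxE /= !mul_mpolyC. Qed.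

Lemma linform_x : linform xvec = 'X_ix.
Proof. by rewrite linform_mkvec scale1r !scale0r !addr0. Qed.
Lemma linform_y : linform yvec = 'X_iy.
Proof. by rewrite linform_mkvec scale1r !scale0r addr0 add0r. Qed.
Lemma linform_code c : linform (codevec c) = line23 K c.1 c.2.
Proof. by rewrite linform_mkvec scaleN1r. Qed.
Lemma linform_H1 : linform (pencilvec 8 27) = H1 K.
Proof. by rewrite linform_mkvec scale0r addr0 scaleNr. Qed.
Lemma linform_H2 : linform (pencilvec 1 1) = H2 K.
Proof. by rewrite linform_mkvec scale0r addr0 scaleN1r scale1r. Qed.

Lemma natK_eq0 m : (m%:R == 0 :> K) = (m == 0)%N.
Proof. exact: (pcharf0P K).1. Qed.

Lemma natK_inj (m n : nat) : m%:R = n%:R :> K -> m = n.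
Proof.
wlog le : m n / (m <= n)%N.
  by move=> W; case/orP: (leq_total m n) => le e; [apply: W|symmetry; apply: W].
by move=> e; have : (n - m)%N%:R == 0 :> K; [rewrite natrB // e subrr|rewrite natK_eq0; lia].
Qed.

Lemma pow_neq0 b i : b.+1%:R ^+ i != 0 :> K.
Proof. by rewrite expf_neq0 // natK_eq0. Qed.

Lemma det3_mkvec (a b c a' b' c' a'' b'' c'' : K) :
  det3 (mkvec a b c 0) (mkvec a' b' c' 0) (mkvec a'' b'' c'' 0) =
  a * (b' * c'' - c' * b'') - b * (a' * c'' - c' * a'') + c * (a' * b'' - b' * a'').
Proof. by rewrite /det3 !mxE /=. Qed.

Lemma det3_swap u v w : det3 (u 0) (w 0) (v 0) = - det3 (u 0) (v 0) (w 0).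
Proof. by rewrite /det3; ring. Qed.

Lemma invpow_inj b i j : (1 < b)%N -> (b%:R ^+ i)^-1 = (b%:R ^+ j)^-1 :> K -> i = j.
Proof.
move=> b1 /invr_inj; rewrite -!natrX => /natK_inj e.
by apply/eqP; rewrite -(eqn_exp2l (m := b)) // e.
Qed.

Lemma det_code_x c c' : c.2 != c'.2 ->
  det3 (codevec c 0) (xvec 0) (codevec c' 0) != 0.
Proof.
move=> ne; rewrite det3_mkvec; apply: contraNneq ne => e; apply/eqP.
apply: (@invpow_inj 3) => //; apply/eqP; rewrite -subr_eq0 -e; apply/eqP; ring.
Qed.

Lemma det_code_y c c' : c.1 != c'.1 ->
  det3 (codevec c 0) (yvec 0) (codevec c' 0) != 0.
Proof.
move=> ne; rewrite det3_mkvec; apply: contraNneq ne => e; apply/eqP.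
apply: (@invpow_inj 2) => //; apply/eqP; rewrite -subr_eq0 -oppr_eq0 -e; apply/eqP; ring.
Qed.

Lemma det_code_xy c : det3 (codevec c 0) (xvec 0) (yvec 0) != 0.
Proof. by rewrite det3_mkvec (_ : _ + _ = - 1) ?oppr_eq0 ?oner_eq0 //; ring. Qed.

Lemma det_code_code c c1 c2 :
  in_band c -> in_band c1 -> in_band c2 -> (c.1 < c1.1)%N -> (c.1 < c2.1)%N ->
  c1.2 != c.2 -> c2.2 != c.2 -> c1 != c2 ->
  det3 (codevec c 0) (codevec c1 0) (codevec c2 0) != 0.
Proof.
case: c c1 c2 => [i j] [i1 j1] [i2 j2] /= h h1 h2 l1 l2 n1 n2 ne.
have := codes_not_collinear h h1 h2 l1 l2 n1 n2 ne; apply: contraNneq => e.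
apply/eqP/natK_inj; rewrite !(natrD, natrM, natrX).
have [x0 x1 x2] := And3 (pow_neq0 1 i) (pow_neq0 1 i1) (pow_neq0 1 i2).
have [y0 y1 y2] := And3 (pow_neq0 2 j) (pow_neq0 2 j1) (pow_neq0 2 j2).
move: e; rewrite det3_mkvec /=.
move: (2%:R ^+ i) (2%:R ^+ i1) (2%:R ^+ i2) (3%:R ^+ j) (3%:R ^+ j1) (3%:R ^+ j2) x0 x1 x2 y0 y1 y2.
move=> X0 X1 X2 Y0 Y1 Y2 x0 x1 x2 y0 y1 y2 e.
apply/eqP; rewrite -subr_eq0 -oppr_eq0; apply/eqP.
rewrite -[RHS](mulr0 (X0 * X1 * X2 * Y0 * Y1 * Y2)) -e.
by field; rewrite x0 x1 x2 y0 y1 y2.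
Qed.

Lemma det_pencil_x a b c : (0 < a)%N ->
  det3 (pencilvec a b 0) (xvec 0) (codevec c 0) != 0.
Proof.
move=> a0; rewrite det3_mkvec (_ : _ + _ = - a%:R); last by ring.
by rewrite oppr_eq0 natK_eq0 -lt0n.
Qed.

Lemma det_pencil_y a b c : (0 < b)%N ->
  det3 (pencilvec a b 0) (yvec 0) (codevec c 0) != 0.
Proof.
move=> a0; rewrite det3_mkvec (_ : _ + _ = - b%:R); last by ring.
by rewrite oppr_eq0 natK_eq0 -lt0n.
Qed.

Lemma det_pencil_code a b c1 c2 :
  (0 < a)%N -> (0 < b)%N -> in_band c1 -> in_band c2 ->
  (4 * b * 2 ^ c1.1 < 9 * a * 3 ^ c1.1)%N || (c1.2 <= c1.1.+1)%N ->
  (4 * b * 2 ^ c2.1 < 9 * a * 3 ^ c2.1)%N || (c2.2 <= c2.1.+1)%N ->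
  c1 != c2 ->
  det3 (pencilvec a b 0) (codevec c1 0) (codevec c2 0) != 0.
Proof.
case: c1 c2 => [i1 j1] [i2 j2] /= a0 b0 h1 h2 w1 w2 ne.
have := weighted_codes_neq a0 b0 h1 h2 w1 w2 ne; apply: contraNneq => e.
apply/eqP/natK_inj; rewrite !(natrD, natrM, natrX).
have [x1 x2] := conj (pow_neq0 1 i1) (pow_neq0 1 i2).
have [y1 y2] := conj (pow_neq0 2 j1) (pow_neq0 2 j2).
move: e; rewrite det3_mkvec /=.
move: (2%:R ^+ i1) (2%:R ^+ i2) (3%:R ^+ j1) (3%:R ^+ j2) x1 x2 y1 y2.
move=> X1 X2 Y1 Y2 x1 x2 y1 y2 e.
apply/eqP; rewrite -subr_eq0 -oppr_eq0; apply/eqP.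
rewrite -[RHS](mulr0 (X1 * X2 * Y1 * Y2)) -e.
by field; rewrite x1 x2 y1 y2.
Qed.

Lemma eq_has_logder (A B : seq vec) d : A =i B -> has_logder A d -> has_logder B d.
Proof.
move=> AB [t [h1 h2 h3]]; exists t; split=> // u uB; apply: h2.
by rewrite AB.
Qed.

(** * The least degree along the construction *)

Definition lines (C : seq (nat * nat)) : seq vec :=
  xvec :: yvec :: map codevec C.

Lemma codevec_inj : injective codevec.
Proof.
move=> [i j] [i' j'] /rowP e; congr pair.
  by apply: (@invpow_inj 2) => //; have := e ix; rewrite !mxE.
by apply: (@invpow_inj 3) => //; have := e iy; rewrite !mxE.
Qed.

Lemma codevec_neq c a b : codevec c != mkvec a b 0.
Proof.
apply/eqP => /rowP /(_ iz); rewrite !mxE /= => /eqP.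
by rewrite oppr_eq0 oner_eq0.
Qed.

Lemma xvec_neq_yvec : xvec != yvec.
Proof. by apply/eqP => /rowP /(_ ix); rewrite !mxE /= => /eqP; rewrite oner_eq0. Qed.

Lemma uniq_lines C : uniq C -> uniq (lines C).
Proof.
move=> uC; rewrite /lines !cons_uniq inE negb_or xvec_neq_yvec.
rewrite map_inj_uniq ?uC; last exact: codevec_inj.
by rewrite !andbT; apply/andP; split; apply/mapP => -[c _ /esym/eqP];
  rewrite (negbTE (codevec_neq _ _ _)).
Qed.

Lemma det3_neq0_sym n : ssrbool.symmetric (fun u v => det3 (n 0) (u 0) (v 0) != 0).
Proof. by move=> u v; rewrite det3_swap oppr_eq0. Qed.

Lemma pairwise_det_codes n (C : seq (nat * nat)) : uniq C ->
  {in C &, forall c1 c2, c1 != c2 ->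
     det3 (n 0) (codevec c1 0) (codevec c2 0) != 0} ->
  pairwise (fun u v => det3 (n 0) (u 0) (v 0) != 0) (map codevec C).
Proof.
rewrite pairwise_map; elim: C => //= c C IH /andP[cC uC] h.
apply/andP; split; last first.
  by apply: IH => // c1 c2 h1 h2; apply: h; rewrite inE ?h1 ?h2 orbT.
apply/allP => c' c'C; apply: h; rewrite ?mem_head // ?inE ?c'C ?orbT //.
by apply: contraNneq cC => ->.
Qed.

(** Two lines line23 with the same i meet on y = 0, and with the same j on x = 0.
    Discarding the at most two codes that share a component with c leaves, with x
    and y, at least size C lines that c meets in distinct points. *)
Lemma has_logder_delete_code C c r1 r2 d :
  uniq (c :: C) -> all in_band (c :: C) -> {in C, forall c', c.1 <= c'.1}%N ->
  {in C, forall c', (c'.1 == c.1) || (c'.2 == c.2) -> c' \in [:: r1; r2]} ->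
  (d < size C)%N -> has_logder (lines (c :: C)) d -> has_logder (lines C) d.-1.
Proof.
move=> /andP[cC uC] /andP[bc bC] le meet hd hl.
pose G := [seq c' <- C | (c'.1 != c.1) && (c'.2 != c.2)].
have hG c' : c' \in G -> [/\ c' \in C, c'.2 != c.2, in_band c' & (c.1 < c'.1)%N].
  rewrite mem_filter => /andP[/andP[n1 n2] c'C]; split=> //; first exact: (allP bC).
  by rewrite ltn_neqAle eq_sym n1 le.
have uG : uniq G by rewrite filter_uniq.
apply: (@has_logder_deletion _ (codevec c) _ (lines G)).
- move=> u; rewrite !inE => /orP[->//|/orP[->|/mapP[c' /hG[c'C _ _ _] ->]]].
    by rewrite orbT.
  by rewrite map_f ?orbT.
- exact: uniq_lines.
- rewrite /= size_map size_filter; apply: leq_trans hd _.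
  rewrite -addn2; apply: (@size_le_count _ _ [:: r1; r2]) => // c' c'C.
  by rewrite negb_and !negbK; apply: meet.
- apply: pairwise_in2; first exact: det3_neq0_sym.
  rewrite /lines /= det_code_xy /=; apply/and3P; split.
  + by apply/allP => _ /mapP[c' /hG[_ h _ _] ->]; rewrite det_code_x // eq_sym.
  + by apply/allP => _ /mapP[c' /hG[_ _ _ h] ->]; rewrite det_code_y // neq_ltn h.
  + apply: pairwise_det_codes => // c1 c2 /hG[_ h1 b1 l1] /hG[_ h2 b2 l2] ne.
    exact: det_code_code.
- move=> u; rewrite !inE => /orP[/eqP->|/orP[/eqP->|/mapP[c' c'C ->]]].
  + by exists yvec; apply: det_code_xy.
  + by exists xvec; rewrite det3_swap oppr_eq0 det_code_xy.
  + have [e2|n2] := eqVneq c.2 c'.2; last first.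
      by exists xvec; rewrite det3_swap oppr_eq0 det_code_x.
    have n1 : c.1 != c'.1.
      apply: contraNneq cC => e1.
      by rewrite (surjective_pairing c) e1 e2 -surjective_pairing.
    by exists yvec; rewrite det3_swap oppr_eq0 det_code_y.
- apply: eq_has_logder hl => u; rewrite /lines /= !inE.
  by do ![case: (u == _) => //=].
Qed.

(** The three codes of smallest first component are deleted one after another.  The
    five lines of the base case have no common point, so no nonzero constant
    field is logarithmic. *)
Lemma no_logder_ladder (k n : nat) : ~ has_logder (lines (ladder k n)) (3 * k + 1)%N.
Proof.
elim: k n => [|k IH] n.
  move=> [t [t_deg t_log t_eul]]; apply: t_eul; exists 0 => i; rewrite mul0r.
  have z u : u != 0 -> u \in lines (ladder 0 n) -> dot3 (cst u) t = 0.
    move=> u0 uA; have [g e] := t_log u uA; rewrite e.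
    have := msize_dot u t_deg; rewrite e => /(msize_linform_factor u0).
    by rewrite leqn0 msize_poly_eq0 => /eqP ->; rewrite mulr0.
  have mk0 (a b c : K) j : mkvec a b c 0 j != 0 -> mkvec a b c != 0.
    by apply: contraNneq => ->; rewrite mxE.
  have x0 : t ix = 0.
    rewrite -(z xvec) ?inE ?eqxx //; last by rewrite (mk0 _ _ _ ix) // mxE oner_eq0.
    by rewrite /dot3 /cst !mxE /= mpolyC1 mpolyC0; ring.
  have y0 : t iy = 0.
    rewrite -(z yvec) ?inE ?eqxx ?orbT //; last by rewrite (mk0 _ _ _ iy) // mxE oner_eq0.
    by rewrite /dot3 /cst !mxE /= mpolyC1 mpolyC0; ring.
  have z0 : t iz = 0.
    apply/eqP; rewrite -oppr_eq0 -(z (codevec (n, n))) ?inE ?eqxx ?orbT //; last first.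
      by rewrite (mk0 _ _ _ iz) // mxE oppr_eq0 oner_eq0.
    rewrite /dot3 x0 y0 /cst !mxE /= mpolyCN mpolyC1; apply/eqP; ring.
  by move: i; apply: ord3_ind.
have band : all in_band (ladder k n.+1).
  by apply/allP => c; rewrite mem_ladder => /and3P[].
(* The three deletions, with the two codes discarded in each of them. *)
have L3 := @has_logder_delete_code (ladder k n.+1) (n, n.+2)
  (n.+1, n.+2) (n.+2, n.+2) (3 * k + 2).
have L2 := @has_logder_delete_code ((n, n.+2) :: ladder k n.+1) (n, n.+1)
  (n, n.+2) (n.+1, n.+1) (3 * k + 3).
have L1 := @has_logder_delete_code [:: (n, n.+1), (n, n.+2) & ladder k n.+1] (n, n)
  (n, n.+1) (n, n.+2) (3 * k + 4).
rewrite (_ : 3 * k.+1 + 1 = 3 * k + 4)%N; last by lia.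
move=> h; apply: (IH n.+1).
rewrite (_ : 3 * k + 1 = (3 * k + 4).-1.-1.-1)%N; last by lia.
rewrite (_ : (3 * k + 4).-1 = 3 * k + 3)%N in L1 *; last by lia.
rewrite (_ : (3 * k + 3).-1 = 3 * k + 2)%N in L2 *; last by lia.
apply: L3; last apply: L2; last apply: L1; last exact: h.
all: rewrite /= ?inE ?xpair_eqE ?uniq_ladder ?band ?size_ladder ?mem_ladder /in_band /=; try lia.
all: by move=> [i j]; rewrite ?inE ?xpair_eqE ?mem_ladder /in_band /=; lia.
Qed.

(** On 27 x = 8 y the codes are separated by 8 / 2^i + 27 / 3^j, which takes the
    value 5 at both (1, 3) and (2, 2), so (1, 3) is discarded; and so is y, which
    meets the line in the same point as x. *)
Lemma no_logder_ladder_H1 k :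
  ~ has_logder (pencilvec 8 27 :: lines (ladder k.+1 1)) (3 * k + 5)%N.
Proof.
have bandL c : c \in ladder k.+1 1 -> in_band c && (0 < c.1)%N.
  by rewrite mem_ladder => /and3P[-> ->].
move=> h; apply: (@no_logder_ladder k.+1 1).
rewrite (_ : 3 * k.+1 + 1 = (3 * k + 5).-1)%N; last by lia.
pose G := [seq c <- ladder k.+1 1 | c != (1, 3)%N].
have uG : uniq G by rewrite filter_uniq ?uniq_ladder.
apply: (@has_logder_deletion _ (pencilvec 8 27) _ (xvec :: map codevec G)) h.
- move=> u; rewrite in_cons => /orP[/eqP->|/mapP[c]]; first exact: mem_head.
  by rewrite mem_filter => /andP[_ hc] ->; rewrite /lines 2!in_cons map_f ?orbT.
- rewrite cons_uniq map_inj_uniq ?uG ?andbT; last exact: codevec_inj.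
  by apply/mapP => -[c _ /esym/eqP]; rewrite (negbTE (codevec_neq _ _ _)).
- have : (3 * k.+1 + 3 <= size G + 1)%N.
    rewrite -(size_ladder k.+1 1) size_filter.
    apply: (@size_le_count _ _ [:: (1, 3)%N]) => [|c _]; first exact: uniq_ladder.
    by rewrite negbK inE.
  rewrite -[size (_ :: _)]/(size (map codevec G)).+1 size_map.
  by move: (size G) => s; lia.
- apply: pairwise_in2; first exact: det3_neq0_sym.
  rewrite pairwise_cons; apply/andP; split.
    by apply/allP => _ /mapP[c _ ->]; apply: det_pencil_x.
  have hG c : c \in G -> in_band c /\
      ((4 * 27 * 2 ^ c.1 < 9 * 8 * 3 ^ c.1)%N || (c.2 <= c.1.+1)%N).
    rewrite mem_filter => /andP[ne /bandL/andP[b c1]]; split=> //.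
    have [c2|c2] := leqP c.1 1; apply/orP; [right|left].
      move: ne b c1 c2; case: (c) => i j; rewrite xpair_eqE /in_band /=; lia.
    have [e ->] : exists e, c.1 = (e + 2)%N by exists (c.1 - 2)%N; lia.
    rewrite !expnD; have : (2 ^ e <= 3 ^ e)%N by rewrite leq_pow23.
    have : (0 < 2 ^ e)%N by rewrite expn_gt0.
    lia.
  by apply: pairwise_det_codes => // c1 c2 /hG[b1 w1] /hG[b2 w2] ne;
     apply: det_pencil_code.
- move=> u; rewrite 2!in_cons => /orP[/eqP->|/orP[/eqP->|/mapP[c _ ->]]].
  + by exists (codevec (0, 0)); apply: det_pencil_x.
  + by exists (codevec (0, 0)); apply: det_pencil_y.
  + by exists xvec; rewrite det3_swap oppr_eq0 det_pencil_x.
Qed.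

(** The three lines x, y and 27 x = 8 y meet x = y in one point, so only x is
    kept among them. *)
Lemma no_logder_ladder_H2 k :
  ~ has_logder [:: pencilvec 1 1, pencilvec 8 27 & lines (ladder k.+1 1)]
      (3 * k + 6)%N.
Proof.
move=> h; apply: (@no_logder_ladder_H1 k).
rewrite (_ : 3 * k + 5 = (3 * k + 6).-1)%N; last by lia.
apply: (@has_logder_deletion _ (pencilvec 1 1) _ (xvec :: map codevec (ladder k.+1 1))) h.
- move=> u; rewrite in_cons => uB; rewrite in_cons /lines 2!in_cons.
  by case/orP: uB => ->; rewrite ?orbT.
- rewrite cons_uniq map_inj_uniq ?uniq_ladder ?andbT; last exact: codevec_inj.
  by apply/mapP => -[c _ /esym/eqP]; rewrite (negbTE (codevec_neq _ _ _)).
- rewrite -[size (_ :: _)]/(size (map codevec (ladder k.+1 1))).+1.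
  by rewrite size_map size_ladder; lia.
- apply: pairwise_in2; first exact: det3_neq0_sym.
  rewrite pairwise_cons; apply/andP; split.
    by apply/allP => _ /mapP[c _ ->]; apply: det_pencil_x.
  have hL c : c \in ladder k.+1 1 -> in_band c /\
      ((4 * 1 * 2 ^ c.1 < 9 * 1 * 3 ^ c.1)%N || (c.2 <= c.1.+1)%N).
    rewrite mem_ladder => /and3P[b _ _]; split=> //; apply/orP; left.
    have : (2 ^ c.1 <= 3 ^ c.1)%N by rewrite leq_pow23.
    have : (0 < 2 ^ c.1)%N by rewrite expn_gt0.
    lia.
  by apply: pairwise_det_codes => [|c1 c2 /hL[b1 w1] /hL[b2 w2] ne];
     [exact: uniq_ladder|apply: det_pencil_code].
- move=> u; rewrite 3!in_cons => /orP[/eqP->|/orP[/eqP->|/orP[/eqP->|/mapP[c _ ->]]]].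
  + exists (codevec (0, 0)); rewrite det3_mkvec (_ : _ + _ = - 19%:R); last by ring.
    by rewrite oppr_eq0 natK_eq0.
  + by exists (codevec (0, 0)); apply: det_pencil_x.
  + by exists (codevec (0, 0)); apply: det_pencil_y.
  + by exists xvec; rewrite det3_swap oppr_eq0 det_pencil_x.
Qed.

(** * The arrangements of the family *)

Definition arrvec (d : nat) : seq vec :=
  let B := lines (base_codes ((d - 2) %/ 3)) in
  match ((d - 2) %% 3)%N with
  | 0 => B
  | 1 => pencilvec 8 27 :: B
  | _ => [:: pencilvec 1 1, pencilvec 8 27 & B]
  end.

Lemma map_linform_arrvec d : map (@linform K) (arrvec d) = arr K d.
Proof.
have hB p : map (@linform K) (lines (base_codes p)) = arr_base K p.
  rewrite arr_baseE /lines 2!map_cons linform_x linform_y -map_comp.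
  by rewrite (eq_map (g := fun c => line23 K c.1 c.2)) // => c; exact: linform_code.
rewrite /arrvec /arr; case: (_ %% _)%N => [|[|m]]; first exact: hB.
  by rewrite map_cons linform_H1 hB.
by rewrite 2!map_cons linform_H1 linform_H2 hB.
Qed.

Lemma no_logder_arrvec d : (8 <= d)%N -> ~ has_logder (arrvec d) (d - 4)%N.
Proof.
move=> d8; have [q qE] : exists q, ((d - 2) %/ 3 = q.+2)%N.
  by exists ((d - 2) %/ 3 - 2)%N; lia.
have dE : d = (3 * q.+2 + (d - 2) %% 3 + 2)%N by rewrite -qE; lia.
have r3 : ((d - 2) %% 3 < 3)%N by rewrite ltn_mod.
have eqL : lines (base_codes q.+2) =i lines (ladder q.+1 1).
  have e := eq_mem_map codevec (mem_base_codes q).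
  by move=> u; rewrite /lines !(in_cons xvec) !(in_cons yvec) e.
rewrite /arrvec qE; move: dE r3; case: (_ %% _)%N => [|[|[|m]]] // -> _ h.
- apply: (@no_logder_ladder q.+1 1); apply: eq_has_logder eqL _.
  by rewrite (_ : 3 * q.+1 + 1 = 3 * q.+2 + 0 + 2 - 4)%N //; lia.
- apply: (@no_logder_ladder_H1 q).
  rewrite (_ : 3 * q + 5 = 3 * q.+2 + 1 + 2 - 4)%N; last by lia.
  apply: eq_has_logder h => u.
  by rewrite !(in_cons (pencilvec 8 27)) eqL.
- apply: (@no_logder_ladder_H2 q).
  rewrite (_ : 3 * q + 6 = 3 * q.+2 + 2 + 2 - 4)%N; last by lia.
  apply: eq_has_logder h => u.
  by rewrite !(in_cons (pencilvec 1 1)) !(in_cons (pencilvec 8 27)) eqL.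
Qed.

(** The point is (2 : 0 : 1), on y = 0 and on line23 1 j for j = 1, 2, 3. *)
Lemma count_off_point d : (8 <= d)%N ->
  (count (fun u : vec => dot3 (u 0) (mkvec 2%:R 0 1 0) != 0)%R (arrvec d) <= d - 4)%N.
Proof.
move=> d8; set P := fun u : vec => _.
have sz : size (arrvec d) = d.
  by rewrite -(size_map (@linform K)) map_linform_arrvec size_arr.
have on : (4 <= count (predC P) (arrvec d))%N.
  pose s := yvec :: map codevec [:: (1, 1); (1, 2); (1, 3)]%N.
  have us : uniq s.
    rewrite cons_uniq map_inj_uniq ?andbT //; last exact: codevec_inj.
    by apply/mapP => -[c _ /esym/eqP]; rewrite (negbTE (codevec_neq _ _ _)).
  rewrite -size_filter -[4%N]/(size s); apply: uniq_leq_size => // u us'.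
  rewrite mem_filter; apply/andP; split.
    rewrite /= /P negbK; move: us'; rewrite !inE.
    have two0 : 2%:R != 0 :> K by rewrite natK_eq0.
    by case/or4P => /eqP ->; rewrite /dot3 !mxE /= ?expr1; apply/eqP;
      [ring|rewrite mulVf // mulr0 addr0 mulr1 addrN..].
  have [q qE] : exists q, ((d - 2) %/ 3 = q.+2)%N.
    by exists ((d - 2) %/ 3 - 2)%N; lia.
  have sub : u \in lines (base_codes ((d - 2) %/ 3)).
    rewrite qE /lines; move: us'; rewrite in_cons => /orP[/eqP->|/mapP[c hc ->]].
      by rewrite 2!in_cons eqxx orbT.
    rewrite 2!in_cons map_f ?orbT // mem_base_codes mem_ladder.
    by move: hc; rewrite !inE => /or3P[] /eqP ->.
  rewrite /arrvec; case: (_ %% _)%N => [|[|m]] //; first by rewrite in_cons sub orbT.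
  by rewrite 2!in_cons sub !orbT.
have := count_predC P (arrvec d); rewrite sz => e; lia.
Qed.

End Arrangements.

Theorem theorem4p10 (K : fieldType) (char0 : [pchar K] =i pred0)
    (d : nat) (hd : (8 <= d)%N) :
  min_syzygy_degree (arr K d) (d - 4)%N.
Proof.
have [uA hA indA] := line_arrangement_arr char0 d.
(* A syzygy of degree s is a logarithmic derivation with msize at most s + 1. *)
have lower s : has_syzygy (defpoly (arr K d)) s -> (d - 4 <= s)%N.
  move=> hs; rewrite leqNgt; apply/negP => lt.
  apply: (no_logder_arrvec char0 hd); apply: has_logder_monotone lt _.
  move: hs uA hA indA; rewrite -map_linform_arrvec => hs uA hA indA.
  apply: logder_of_syzygy hs => //.
  - by rewrite -(size_map (@linform K)) map_linform_arrvec size_arr //; lia.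
  - exact: map_uniq uA.
  - by move=> u uin; rewrite -linform_eq0; have [] := hA _ (map_f _ uin).
  - move=> u v uin vin ne c; apply: contraTneq isT => e.
    have := indA _ _ (map_f _ vin) (map_f _ uin); rewrite (inj_eq (@linform_inj K)) eq_sym.
    move=> /(_ ne c) /eqP; case; rewrite e.
    by rewrite /linform /dot3 /cst !mxE !mpolyCM -mul_mpolyC; ring.
split=> //.
have [p0 pA] : (mkvec 2%:R 0 1 : 'rV[K]_3) != 0 /\ (0 < size (arrvec K d))%N.
  split; last by rewrite -(size_map (@linform K)) map_linform_arrvec size_arr //; lia.
  by apply/eqP => /rowP /(_ iz); rewrite !mxE /= => /eqP; rewrite oner_eq0.
have A0 : {in arrvec K d, forall u, u != 0}.
  move=> u uin; rewrite -linform_eq0; have := map_f (@linform K) uin.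
  by rewrite map_linform_arrvec => /hA[].
have := syzygy_of_point char0 p0 pA A0; rewrite map_linform_arrvec => hs.
suff <- : count (fun u : 'rV[K]_3 => dot3 (u 0) (mkvec 2%:R 0 1 0) != 0) (arrvec K d) = (d - 4)%N by [].
by apply/eqP; rewrite eqn_leq count_off_point // lower.
Qed.
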